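(* Let $\mathscr{G}$ be a hereditary family of graphs with the following property: there exists $t\in\mathbb{N}$ such that for any $G\in\mathscr{G}$ there is a separator $G'$ of $G$ with $\mathrm{reg}(G')\leq t$. Then the regularity $\mathrm{reg}(G)$ of any $G\in\mathscr{G}$ is at most $t+1$.
   Context: All graphs are finite and simple. A family of graphs is hereditary if it is closed under vertex deletion (equivalently, under taking induced subgraphs). A separator of $G$ is an induced subgraph $T$ of $G$ such that the induced subgraph of $G$ on $V(G)\setminus V(T)$ is disconnected. Fix a field $k$ of characteristic $0$. For a graph $G$ with vertex set $[n]=\{1,\dots,n\}$, the non-edge ideal is $I(G)=\langle x_ix_j : i\neq j,\ ij\notin E(G)\rangle\subseteq k[x_1,\dots,x_n]$, and $\mathrm{reg}(G):=\max\{r : \beta_{i,i+r}(I(G))\neq 0 \text{ for some } i\}$ is its Castelnuovo-Mumford regularity, where $\beta_{i,j}$ are the graded Betti numbers. If $G$ is complete (so that $I(G)$ has no generators), $\mathrm{reg}(G)=1$ by convention. *)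

(* Defs.v *)
From Stdlib Require Import ClassicalEpsilon.
From mathcomp Require Import all_boot all_algebra.
From mathcomp Require Import mpoly.

Set Implicit Arguments.
Unset Strict Implicit.
Unset Printing Implicit Defensive.

Import GRing.Theory.
Local Open Scope ring_scope.

(** * Graphs *)

Record graph (n : nat) := Graph {
  adj :> rel 'I_n;
  adj_sym : ssrbool.symmetric adj;
  adj_irr : irreflexive adj }.

Definition complete n (G : graph n) : bool :=
  [forall i, forall j, (i != j) ==> G i j].

Section Induced.
Variables (n : nat) (G : graph n) (W : {set 'I_n}).

(* The vertices of [W] are renumbered increasingly by [enum_val]. *)
Definition induced_adj : rel 'I_#|W| := fun i j => G (enum_val i) (enum_val j).

Lemma induced_adj_sym : ssrbool.symmetric induced_adj.
Proof. by move=> i j; exact: adj_sym. Qed.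

Lemma induced_adj_irr : irreflexive induced_adj.
Proof. by move=> i; exact: adj_irr. Qed.

Definition induced : graph #|W| := Graph induced_adj_sym induced_adj_irr.
End Induced.

(* The graph without vertices is not disconnected. *)
Definition disconnected n (G : graph n) : bool :=
  [exists u, exists v, ~~ connect G u v].

(* A complete graph has no separator. *)
Definition separator n (G : graph n) (T : {set 'I_n}) : bool :=
  disconnected (induced G (~: T)).

Definition graph_family := forall n : nat, graph n -> Prop.

Definition hereditary (F : graph_family) : Prop :=
  forall n (G : graph n) (W : {set 'I_n}), F n G -> F #|W| (induced G W).

(** * Graded Betti numbers *)

Section Resolutions.
Variables (k : fieldType) (n : nat).
Local Notation S := {mpoly k[n]}.

Definition nonedge_ideal (G : graph n) : S -> Prop := fun f =>
  exists c : 'I_n -> 'I_n -> S,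
    f = \sum_i \sum_(j | (i != j) && ~~ G i j) c i j * ('X_i * 'X_j).

(* A sequence ... -> F_1 -> F_0 -> S of finitely generated graded free modules:
   F_i is the module of row vectors of length [rk i], its a-th basis vector has
   degree [deg a], and maps are given by right multiplication by matrices. *)
Record free_seq := FreeSeq {
  rk : nat -> nat;
  deg : forall i, 'I_(rk i) -> nat;
  diff : forall i, 'M[S]_(rk i.+1, rk i);
  aug : 'cV[S]_(rk 0) }.

Definition free_seq0 : free_seq :=
  @FreeSeq (fun=> 0%N) (fun _ _ => 0%N) (fun=> 0) 0.

(* Homogeneous of degree [e - d], hence zero when [e < d]. *)
Definition homog_diff (e d : nat) (p : S) : bool :=
  (p == 0) || (d <= e)%N && (p \is (e - d).-homog).

Definition graded_maps (F : free_seq) : Prop :=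
  (forall a, aug F a 0 \is (deg a).-homog) /\
  (forall i a b, homog_diff (deg a) (deg b) (diff F i a b)).

Definition resolves (I : S -> Prop) (F : free_seq) : Prop :=
  [/\ forall f, I f <-> exists v : 'rV_(rk F 0), (v *m aug F) 0 0 = f,
      forall v : 'rV_(rk F 0),
        v *m aug F = 0 <-> exists w, v = w *m diff F 0
    & forall i (v : 'rV_(rk F i.+1)),
        v *m diff F i = 0 <-> exists w, v = w *m diff F i.+1].

(* The differentials have their entries in the ideal of the variables. *)
Definition minimal (F : free_seq) : Prop :=
  forall i a b, (diff F i a b)@_0%MM = 0.

Definition min_graded_free_resolution (I : S -> Prop) (F : free_seq) : Prop :=
  [/\ graded_maps F, resolves I F & minimal F].

(* Such resolutions of a homogeneous ideal exist and are isomorphic, so the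
   choice made here does not affect the Betti numbers. *)
Definition min_res (I : S -> Prop) : free_seq :=
  epsilon (inhabits free_seq0) (min_graded_free_resolution I).

Definition betti (I : S -> Prop) (i j : nat) : nat :=
  #|[set a : 'I_(rk (min_res I) i) | deg a == j]|.

End Resolutions.

Arguments nonedge_ideal k {n} G.

(** * Regularity *)

Definition is_max (P : nat -> Prop) (r : nat) : Prop :=
  P r /\ forall s, P s -> (s <= r)%N.

Definition reg (k : fieldType) n (G : graph n) : nat :=
  if complete G then 1%N
  else epsilon (inhabits 0%N)
         (is_max (fun r => exists i, betti (nonedge_ideal k G) i (i + r) <> 0%N)).

(* Main.v *)
(** Koszul homology of the submodules of a minimal graded free resolution is
    shifted by one from each module to its syzygies, so that [betti I i (i + r)]
    is nonzero exactly when the Koszul homology of [I] is nonzero in homological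
    degree [i] and internal degree [i + r]. For the monomial ideal of the
    non-edges of [G] this homology splits into multigraded pieces, which vanish
    unless the multidegree is squarefree (Hochster); the piece of a vertex set
    [W] with [i + r] elements is the relative cohomology of the pair formed by
    the simplex on [W] and its subcomplex of cliques. Hence [reg G <= t] means
    that the reduced cohomology of the clique complex of every induced subgraph
    vanishes in dimensions at least [t - 1]. If [T] separates [G], its clique
    complex is the union of two clique complexes of smaller induced subgraphs
    meeting in that of [T], and the Mayer-Vietoris sequence bounds the
    regularity by induction on the number of vertices.

    The same dimension shift gives the existence of the minimal resolution: the
    Koszul homology of [I] lives in bounded degrees, hence so does that of every
    syzygy module, and a graded submodule whose minimal generators have bounded
    degrees is finitely generated. *)

Require Import Defs.
From HB Require Import structures.
From Stdlib Require Import ClassicalEpsilon.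
From mathcomp Require Import all_boot all_algebra.
From mathcomp Require Import mpoly zify ring.

Set Implicit Arguments.
Unset Strict Implicit.
Unset Printing Implicit Defensive.

Import GRing.Theory.
Local Open Scope ring_scope.

(** * Clique complexes *)

Section Signs.
Variables (n : nat) (R : nzRingType).
Implicit Types (r s : {set 'I_n}) (u v : 'I_n).

(** The sign of sorting [v] into [s], as for the wedge product of [e_v] with [e_s]. *)
Definition sgn v s : R := (-1) ^+ #|[set u in s | (u < v)%N]|.

Lemma sgn_sqr v s : sgn v s * sgn v s = 1.
Proof. by rewrite -expr2 sqrr_sign. Qed.

Lemma sgn_setU1 u v s : u \notin s ->
  sgn v (u |: s) = (-1) ^+ (u < v)%N * sgn v s.
Proof.
move=> us; rewrite /sgn -exprD; congr (_ ^+ _).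
have -> : [set w in u |: s | (w < v)%N] =
  (if (u < v)%N then [set u] else set0) :|: [set w in s | (w < v)%N].
  apply/setP=> w; case: ifP => uv; rewrite !inE //.
    by case: eqVneq => [->|_] //=; rewrite uv.
  by case: eqVneq => [->|_] //=; rewrite uv (negPf us).
case: ifP => _; last by rewrite set0U.
by rewrite cardsU1 inE (negPf us).
Qed.

Lemma sgn_anticomm u v s : u != v -> u \notin s -> v \notin s ->
  sgn v (u |: s) * sgn u s = - (sgn u (v |: s) * sgn v s).
Proof.
move=> uv us vs; rewrite !sgn_setU1 // -!mulrA.
have -> : sgn u s * sgn v s = sgn v s * sgn u s by rewrite -!exprD addnC.
rewrite -mulNr; congr (_ * _).
by case: ltngtP (uv) => [||/val_inj->]; rewrite ?eqxx // !expr0 !expr1 ?opprK.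
Qed.

(** Splitting the inner sum at [u < v] and exchanging the sums in one half pairs [T u v] with
    [T v u]. As the diagonal is left out, this is valid in characteristic 2 too. Both [cobd_cobd]
    and [koszul_koszul] rest on it. *)
Lemma sum_antisym (V : zmodType) (P : pred 'I_n) (T : 'I_n -> 'I_n -> V) :
    (forall u v, u != v -> P u -> P v -> T u v = - T v u) ->
  \sum_(v | P v) \sum_(u | P u && (u != v)) T u v = 0.
Proof.
move=> antiT.
under eq_bigr => v _ do rewrite (bigID (fun u : 'I_n => (u < v)%N)) /=.
rewrite big_split /= [X in X + _](exchange_big_dep P) //=; last first.
  by move=> v u Pv /andP[/andP[]].
rewrite -big_split /= big1 // => v Pv.
rewrite addrC (eq_bigl (fun u => P u && (v < u)%N)); last first.
  by move=> u; rewrite /=; case: (P u); rewrite //= -leqNgt ltn_neqAle eq_sym.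
rewrite [X in _ + X](eq_bigl (fun u => P u && (v < u)%N)); last first.
  move=> u; rewrite /= Pv /=; case: (P u) => //=.
  by case: ltnP => //; rewrite ?andbF // => vu; rewrite andbT neq_ltn vu.
rewrite -big_split big1 //= => u /andP[Pu vu].
by rewrite antiT ?addNr // neq_ltn vu orbT.
Qed.
End Signs.

Lemma card_setD1 n (s : {set 'I_n}) v d : v \in s -> #|s| = d.+1 ->
  #|s :\ v| = d.
Proof. by move=> vs sd; move: (cardsD1 v s); rewrite vs sd => -[]. Qed.

(** * Simplicial cochains, cones and Mayer-Vietoris *)

Section Cochains.
Variables (n : nat) (k : fieldType).
Implicit Types (f g h : {set 'I_n} -> k) (r s : {set 'I_n}) (u v : 'I_n).

(** Cochains of all dimensions live in one function on vertex sets. The empty set counts as a face,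
    so the cohomology is reduced. *)
Definition cobd f s : k := \sum_(v in s) sgn k v (s :\ v) * f (s :\ v).

Lemma cobdB f g s : cobd (fun r => f r - g r) s = cobd f s - cobd g s.
Proof. by rewrite /cobd -sumrB; apply: eq_bigr => v _; rewrite mulrBr. Qed.

Lemma eq_cobd f g s : (forall v, v \in s -> f (s :\ v) = g (s :\ v)) ->
  cobd f s = cobd g s.
Proof. by move=> fg; apply: eq_bigr => v vs; rewrite fg. Qed.

Lemma cobd_cobd f s : cobd (cobd f) s = 0.
Proof.
pose T u v : k :=
  sgn k v (s :\ v) * (sgn k u (s :\ v :\ u) * f (s :\ v :\ u)).
rewrite -[RHS](@sum_antisym n k (mem s) T) /T; last first.
  move=> u v uv us vs; rewrite !mulrA -mulNr.
  have -> : s :\ v :\ u = s :\ u :\ v by apply/setP=> w; rewrite !inE andbCA.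
  congr (_ * _); set q := s :\ u :\ v.
  have -> : s :\ v = u |: q.
    apply/setP=> w; rewrite !inE; case: (eqVneq w u) => [->|];
      rewrite /= ?uv ?us //.
  have -> : s :\ u = v |: q.
    by apply/setP=> w; rewrite !inE; case: (eqVneq w v) => [->|];
      rewrite ?vs ?andbT // eq_sym uv.
  by rewrite sgn_anticomm ?inE ?eqxx ?andbF.
apply: eq_bigr => v vs; rewrite /cobd mulr_sumr.
by apply: eq_bigl => u; rewrite !inE andbC.
Qed.

Definition cone u f s : k := if u \in s then 0 else sgn k u s * f (u |: s).

(** The cone with apex [u] contracts the full simplex. The term that removes [u] gives [f s]; all
    other terms vanish or cancel in pairs, as insertions of two vertices anticommute. *)
Lemma cobd_cone u f s : cobd (cone u f) s = f s - cone u (cobd f) s.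
Proof.
rewrite /cone; case: ifPn => us.
  rewrite subr0 /cobd (bigD1 u) //= big1 => [|v /andP[vs vu]].
    by rewrite setD11 setD1K // mulrA sgn_sqr mul1r addr0.
  by rewrite !inE eq_sym vu us mulr0.
rewrite /cobd [X in _ - _ * X](bigD1 u) ?setU11 //= setU1K // mulrDr mulrA.
rewrite sgn_sqr mul1r opprD addNKr mulr_sumr -sumrN.
rewrite [RHS](eq_bigl (mem s)) /=; last first.
  by move=> v; rewrite !inE; case: eqVneq => [->|]; rewrite ?(negPf us) ?andbT.
apply: eq_bigr => v vs.
have vu : v != u by apply: contraNneq us => <-.
rewrite !inE eq_sym (negPf vu) (negPf us) /=.
have -> : (u |: s) :\ v = u |: (s :\ v).
  by apply/setP=> w; rewrite !inE; case: (eqVneq w u) => [->|];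
    rewrite // eq_sym vu.
rewrite !mulrA -mulNr; congr (_ * _).
have sE := setD1K vs; set q := s :\ v in sE *; rewrite -[in RHS]sE.
have uq : u \notin q by rewrite inE negb_and us orbT.
have vq : v \notin q by rewrite setD11.
rewrite !sgn_setU1 // mulrACA -mulNr [sgn k u q * _]mulrC.
rewrite -[LHS]mul1r; congr (_ * _).
by case: ltngtP (vu) => [||/val_inj->];
  rewrite ?eqxx // !expr0 !expr1 ?mulr1 ?mul1r opprK.
Qed.

Variable G : graph n.

Definition clique s : bool :=
  [forall u in s, forall v in s, (u != v) ==> G u v].

Lemma cliqueP s :
  reflect {in s &, forall u v, u != v -> G u v} (clique s).
Proof.
apply: (iffP forall_inP) => [h u v us vs uv|h u us].
  by have /forall_inP/(_ v vs)/implyP := h u us; apply.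
by apply/forall_inP=> v vs; apply/implyP; apply: h.
Qed.

Lemma sub_clique r s : r \subset s -> clique s -> clique r.
Proof.
by move=> /subsetP rs /cliqueP h; apply/cliqueP => u v /rs us /rs vs; apply: h.
Qed.

Lemma card_cliqueN s : ~~ clique s -> (1 < #|s|)%N.
Proof.
apply: contraR; rewrite -leqNgt => /card_le1P h.
by apply/cliqueP => u v us vs; move: vs; rewrite (h u us) inE eq_sym => ->.
Qed.

(* Vanishing of the reduced cohomology of the clique complex of [G] induced on
   [U] in dimension [d - 1], whose cochains are functions of the cliques with
   [d] vertices. *)
Definition acyclic (U : {set 'I_n}) d : Prop :=
  forall g,
    (forall s, s \subset U -> clique s -> #|s| = d.+1 -> cobd g s = 0) ->
  exists h, forall s, s \subset U -> clique s -> #|s| = d -> g s = cobd h s.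

(* The same for the pair formed by the full simplex on [U] and the clique
   complex, in dimension [d - 1]. *)
Definition rel_acyclic (U : {set 'I_n}) d : Prop :=
  forall f,
    (forall s, s \subset U -> clique s -> f s = 0) ->
    (forall s, s \subset U -> #|s| = d.+1 -> cobd f s = 0) ->
  exists2 g, forall s, s \subset U -> clique s -> g s = 0
           & forall s, s \subset U -> #|s| = d -> f s = cobd g s.

(** A cone over any vertex of [U] gives the primitive. The disjunction excludes the empty simplex in
    degree 0, whose only face carries a reduced class. *)
Lemma simplex_acyclic U f d : (U != set0) || (0 < d)%N ->
    (forall s, s \subset U -> #|s| = d.+1 -> cobd f s = 0) ->
  exists h, forall s, s \subset U -> #|s| = d -> f s = cobd h s.
Proof.
case: (set_0Vmem U) => [->|[u uU]] U0 cf.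
  exists f => s; rewrite subset0 => /eqP-> d0.
  by move: U0; rewrite -d0 cards0 eqxx.
exists (cone u f) => s sU sd; rewrite cobd_cone /cone; case: ifPn => us.
  by rewrite subr0.
by rewrite cf ?mulr0 ?subr0 ?subUset ?sub1set ?uU // cardsU1 us sd.
Qed.

Lemma clique_acyclic U d : (U != set0) || (0 < d)%N -> clique U -> acyclic U d.
Proof.
move=> Ud cU g cg.
have [s sU|h hP] := simplex_acyclic Ud (f := g).
  by apply: cg => //; apply: sub_clique cU.
by exists h => s sU _; apply: hP.
Qed.

(** The long exact sequence of the pair: the full simplex is acyclic, so the connecting map, which
    extends a cochain by zero and takes its coboundary, is an isomorphism. *)
Lemma rel_acyclicP U d : (0 < d)%N -> rel_acyclic U d.+1 <-> acyclic U d.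
Proof.
move=> d0; have Ud e : (U != set0) || (0 < e + d)%N.
  by rewrite addn_gt0 d0 !orbT.
split=> [H g cg | H f f0 cf].
  pose g' s := if clique s then g s else 0.
  have clD s v : clique s -> clique (s :\ v).
    by apply: sub_clique; rewrite subsetDl.
  (* The coboundary of [g'] is known to vanish on cliques with [d.+1] vertices only, whereas [H]
     asks for all cliques, hence the cutoff. *)
  pose f s := if (#|s| == d.+1) then cobd g' s else 0.
  have [s sU cs|s sU sd|e e0 eP] := H f.
  - rewrite /f; case: eqP => // sd; rewrite (@eq_cobd _ g) ?cg //.
    by move=> v vs; rewrite /g' clD.
  - rewrite (@eq_cobd _ (cobd g')) ?cobd_cobd // => v vs.
    by rewrite /f (card_setD1 vs sd) eqxx.
  have [s sU sd|h hP] := @simplex_acyclic U (fun s => g' s - e s) d (Ud 0%N).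
    by rewrite cobdB -eP // /f sd eqxx subrr.
  exists h => s sU cs sd; rewrite -hP //.
  by rewrite e0 // subr0 /g' cs.
have [e eP] := simplex_acyclic (Ud 1%N) cf.
have [s sU cs sd|h hP] := H e; first by rewrite -eP // f0.
exists (fun s => if clique s then 0 else e s - cobd h s) => [s sU ->//|s sU sd].
rewrite eP // -[LHS]subr0 -[X in _ - X = _](cobd_cobd h s) -cobdB;
  apply: eq_cobd => v vs.
case: ifPn => // cs; apply/eqP; rewrite subr_eq0; apply/eqP/hP => //.
  by apply: subset_trans sU; rewrite subsetDl.
exact: card_setD1 sd.
Qed.

Lemma rel_acyclic_card U d : ~ rel_acyclic U d -> (d <= #|U|)%N.
Proof.
move=> H; case: leqP => // Ud; case: H => f f0 cf;
  exists (fun=> 0) => // s sU sd.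
by move: (subset_leq_card sU); rewrite sd leqNgt Ud.
Qed.

(** Two isolated points: the indicator of [u] is a cocycle, but a coboundary takes the value
    [h set0] at both points. *)
Lemma nonadj_not_acyclic u v : u != v -> ~~ G u v -> ~ acyclic [set u; v] 1.
Proof.
move=> uv Guv H.
pose g s : k := (s == [set u])%:R.
have [s sU cs s2|h hP] := H g.
  have sE : s = [set u; v].
    by apply/eqP; rewrite eqEcard sU cards2 uv s2.
  by move/cliqueP: cs; rewrite sE => /(_ u v);
    rewrite !inE !eqxx orbT uv (negPf Guv) => /(_ isT isT isT).
have cl1 (w : 'I_n) : clique [set w].
  by apply: contraT => /card_cliqueN; rewrite cards1.
have E w : cobd h [set w] = h set0.
  rewrite /cobd big_set1 setDv /sgn.
  have -> : [set x : 'I_n in set0 | (x < w)%N] = set0.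
    by apply/setP=> x; rewrite !inE.
  by rewrite cards0 expr0 mul1r.
have := hP [set u]; have := hP [set v].
rewrite !E !sub1set !inE !eqxx orbT !cl1 !cards1 =>
  /(_ isT isT erefl) <- /(_ isT isT erefl) /eqP.
rewrite /g eqxx (inj_eq set1_inj) eq_sym [v == u]eq_sym (negPf uv) eq_sym.
by rewrite oner_eq0.
Qed.

(** Primitives of [g] on the two sides differ on the intersection by a cocycle, that is by some
    [cobd l]. Subtracting [cobd l] from the first one lets them be glued. *)
Lemma mayer_vietoris U1 U2 d :
    (forall s, s \subset U1 :|: U2 -> clique s ->
      (s \subset U1) || (s \subset U2)) ->
    acyclic U1 d.+1 -> acyclic U2 d.+1 -> acyclic (U1 :&: U2) d ->
  acyclic (U1 :|: U2) d.+1.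
Proof.
move=> cov H1 H2 H12 g cg.
have [s sU|h1 h1P] := H1 g.
  by apply: cg; apply: subset_trans sU (subsetUl _ _).
have [s sU|h2 h2P] := H2 g.
  by apply: cg; apply: subset_trans sU (subsetUr _ _).
have [s|l lP] := H12 (fun s => h1 s - h2 s).
  by rewrite subsetI => /andP[s1 s2] cs sd; rewrite cobdB -h1P // -h2P // subrr.
exists (fun s => if s \subset U1 then h1 s - cobd l s else h2 s) => s sU cs sd.
have sD (v : 'I_n) : s :\ v \subset s by rewrite subsetDl.
case/orP: (cov s sU cs) => s1.
  rewrite h1P // -[LHS]subr0 -[X in _ - X = _](cobd_cobd l s) -cobdB;
    apply: eq_cobd => v vs.
  by rewrite (subset_trans (sD v) s1).
rewrite h2P //; apply: eq_cobd => v vs; case: ifPn => // s2.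
rewrite -lP ?opprB ?subrKC ?subsetI ?s2 //.
- exact: subset_trans (sD v) s1.
- exact: sub_clique cs.
exact: card_setD1 sd.
Qed.
End Cochains.

(** * Renumbering of induced subgraphs *)

Lemma sgn_imset n m (R : nzRingType) (phi : 'I_m -> 'I_n) v (s : {set 'I_m}) :
    (forall i j, (phi i < phi j)%N = (i < j)%N) -> injective phi ->
  sgn R (phi v) (phi @: s) = sgn R v s.
Proof.
move=> phi_lt phi_inj; congr (_ ^+ _); rewrite -(card_imset _ phi_inj).
apply: eq_card => w; apply/idP/imsetP.
  rewrite inE => /andP[/imsetP[u us ->]]; rewrite phi_lt => uv.
  by exists u => //; rewrite inE us.
move=> [u us ->]; move: us; rewrite !inE phi_lt => /andP[us ->].
by rewrite imset_f.
Qed.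

(** [enum] follows the order of the ordinals, so renumbering preserves signs by [sgn_imset]. *)
Lemma enum_val_ltn n (W : {set 'I_n}) (i j : 'I_#|W|) :
  (enum_val i < enum_val j)%N = (i < j)%N.
Proof.
have so : sorted ltn (map val (enum W)).
  rewrite sorted_map {1}/enum_mem -enumT; apply: sorted_filter.
    by move=> x y z; apply: ltn_trans.
  by rewrite -sorted_map val_enum_ord iota_ltn_sorted.
have W0 : 'I_n by apply: (enum_val i).
have E (x : 'I_#|W|) : val (enum_val x) = nth 0%N (map val (enum W)) x.
  by rewrite (nth_map W0) -?cardE // -(enum_val_nth W0).
have mono (x y : 'I_#|W|) : (x < y)%N -> (enum_val x < enum_val y)%N.
  move=> xy; rewrite !E; apply: (sorted_ltn_nth ltn_trans) => //;
  by rewrite inE size_map -cardE.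
case: (ltngtP i j) => [/mono|/mono|/val_inj->]; rewrite ?ltnn //.
by move=> ji; apply/negbTE; rewrite -leqNgt ltnW.
Qed.

Lemma acyclic_induced n (k : fieldType) (G : graph n) (W : {set 'I_n}) d :
  acyclic k (induced G W) setT d -> acyclic k G W d.
Proof.
set H := induced G W => aH g cg.
pose phi := (enum_val : 'I_#|W| -> 'I_n).
have phi_inj : injective phi by apply: enum_val_inj.
have cobd_phi f (s : {set 'I_#|W|}) :
  cobd f (phi @: s) = cobd (fun r => f (phi @: r)) s.
  rewrite /cobd big_imset /=; last by move=> x y _ _; apply: phi_inj.
  apply: eq_bigr => v vs; have -> : phi @: s :\ phi v = phi @: (s :\ v).
    apply/setP=> x; rewrite !inE;
      apply/andP/imsetP => [[+ /imsetP[y ys xE]]|[y]].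
      by rewrite xE (inj_eq phi_inj) => yv; exists y; rewrite // !inE yv.
    by rewrite !inE => /andP[yv ys] ->; rewrite (inj_eq phi_inj) yv imset_f.
  by rewrite sgn_imset //; apply: enum_val_ltn.
have clique_phi (s : {set 'I_#|W|}) : clique G (phi @: s) = clique H s.
  apply/cliqueP/cliqueP => h u v.
    by move=> us vs uv; apply: (h (phi u) (phi v));
      rewrite ?imset_f ?(inj_eq phi_inj).
  move=> /imsetP[x xs ->] /imsetP[y ys ->]; rewrite (inj_eq phi_inj); exact: h.
have phi_sub (s : {set 'I_#|W|}) : phi @: s \subset W.
  by apply/subsetP => x /imsetP[y _ ->]; apply: enum_valP.
have [s _ cs sd|h hP] := aH (fun s => g (phi @: s)).
  by rewrite -cobd_phi cg ?clique_phi ?card_imset.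
exists (fun s : {set 'I_n} => h (phi @^-1: s)) => s sW cs sd.
have sE : s = phi @: (phi @^-1: s).
  apply/setP => x; apply/idP/imsetP => [xs|[y]]; last by rewrite inE => ys ->.
  have xW := subsetP sW _ xs.
  by exists (enum_rank_in xW x); rewrite ?inE /phi enum_rankK_in.
rewrite {1}sE hP ?subsetT // -?clique_phi -?(card_imset _ phi_inj) -?sE //.
rewrite [in RHS]sE cobd_phi; apply: eq_cobd => v vs; congr h.
by apply/setP => x; rewrite [RHS]inE (mem_imset _ _ phi_inj).
Qed.

(** * Koszul homology of monomial ideals *)

Section Twist.
Variables (n : nat) (k : fieldType).
Implicit Types (c e f g : {set 'I_n} -> k) (r s W : {set 'I_n}) (u v : 'I_n).

(** The Koszul differential in one fixed multidegree, where only scalars remain; see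
    [component_koszul_diff]. *)
Definition chbd c s : k := \sum_(v | v \notin s) sgn k v s * c (v |: s).

(* Complementation in [W] turns the Koszul-type differential [chbd] into the
   simplicial coboundary, up to these signs. *)
Definition twist_sgn W r : k := \prod_(v in r) sgn k v W.

Lemma twist_sgn_sqr W r : twist_sgn W r * twist_sgn W r = 1.
Proof. by rewrite -big_split /= big1 // => v _; apply: sgn_sqr. Qed.

Definition twist W c r : k := twist_sgn W r * c (W :\: r).

Lemma sgn_setD W r v : r \subset W -> v \in r ->
  sgn k v W = sgn k v (W :\: r) * sgn k v (r :\ v).
Proof.
move=> rW vr; rewrite /sgn -exprD; congr (_ ^+ _).
rewrite -(cardsID (W :\: r)); congr (_ + _)%N; apply: eq_card => u;
  rewrite !inE.
  by case: (u \in W); rewrite ?andbF //= andbT andbC.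
rewrite negb_and negbK; case: (boolP (u \in W)) => uW /=.
  by rewrite orbF; case: eqVneq => [->|]; rewrite ?ltnn ?andbF.
by rewrite andbF (contraNF (subsetP rW u)) // andbF.
Qed.

(** Removing [v] from [r] adds it to the complement in [W], and [sgn_setD] matches the signs. The
    support hypothesis on [c] kills the terms with [v] outside [W]. *)
Lemma cobd_twist W c r : r \subset W ->
    (forall s, ~~ (s \subset W) -> c s = 0) ->
  cobd (twist W c) r = twist_sgn W r * chbd c (W :\: r).
Proof.
move=> rW c0; rewrite /chbd (bigID (mem r)) /= addrC big1 => [|v]; last first.
  rewrite !inE negb_and negbK => /andP[/orP[->//|vW] _].
  by rewrite c0 ?mulr0 // subUset sub1set (negPf vW).
rewrite add0r (eq_bigl (mem r)) => [|v]; last first.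
  by rewrite /= !inE; case: (v \in r); rewrite ?andbF.
rewrite mulr_sumr; apply: eq_bigr => v vr; rewrite /twist /twist_sgn.
rewrite [in RHS](big_setD1 v) //= (sgn_setD rW vr).
have -> : W :\: (r :\ v) = v |: (W :\: r).
  apply/setP => u; rewrite !inE; case: eqVneq => [->|] //=.
  exact: (subsetP rW).
set x := sgn k v (W :\: r); set y := sgn k v _; set p := \prod_(_ in _) _.
by rewrite -[LHS]mul1r -(sgn_sqr k v (W :\: r)) -/x; ring.
Qed.

Lemma setDDK W r : r \subset W -> W :\: (W :\: r) = r.
Proof. by move=> rW; rewrite setDDr setDv set0U; apply/setIidPr. Qed.

Definition untwist W f s : k :=
  if s \subset W then twist_sgn W (W :\: s) * f (W :\: s) else 0.

Lemma twist_untwist W f r : r \subset W -> twist W (untwist W f) r = f r.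
Proof.
move=> rW; rewrite /twist /untwist subsetDl setDDK //.
by rewrite mulrA twist_sgn_sqr mul1r.
Qed.

Lemma twist_sgn_inj W r : injective (fun x => twist_sgn W r * x).
Proof.
by move=> x y /= /(congr1 (fun w => twist_sgn W r * w));
  rewrite !mulrA twist_sgn_sqr !mul1r.
Qed.

Lemma cobd_untwist W f s : s \subset W ->
  cobd f (W :\: s) = twist_sgn W (W :\: s) * chbd (untwist W f) s.
Proof.
move=> sW; rewrite -[s in chbd _ s](setDDK sW) -cobd_twist ?subsetDl //.
  apply: eq_cobd => v _; rewrite twist_untwist //.
  by rewrite (subset_trans (subsetDl _ _)) ?subsetDl.
by move=> r /negPf; rewrite /untwist => ->.
Qed.

Lemma chbd_eq0 c s : (forall v, v \notin s -> c (v |: s) = 0) -> chbd c s = 0.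
Proof. by move=> c0; apply: big1 => v /c0->; rewrite mulr0. Qed.

Lemma eq_chbd c e s : (forall v, v \notin s -> c (v |: s) = e (v |: s)) ->
  chbd c s = chbd e s.
Proof. by move=> ce; apply: eq_bigr => v /ce->. Qed.

(** Complementation turns the cone homotopy into the wedge product with [e_u]: up to sign, [e s] is
    [c (s :\ u)] if [u] lies in [s] and 0 otherwise. The last clause records this control of the
    support. *)
Lemma chbd_contract u c : (forall s, chbd c s = 0) ->
  exists2 e, forall s, chbd e s = c s &
             forall s, (u \notin s) || (c (s :\ u) == 0) -> e s = 0.
Proof.
move=> c0; pose f := twist setT c.
have cf r : cobd f r = 0.
  by rewrite cobd_twist ?subsetT ?c0 ?mulr0 // => s; rewrite subsetT.
exists (untwist setT (cone u f)) => s.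
  have := @cobd_twist setT (untwist setT (cone u f)) (~: s) (subsetT _).
  rewrite (@eq_cobd _ _ _ (cone u f)) => [|v _]; last first.
    by rewrite twist_untwist ?subsetT.
  rewrite cobd_cone /cone cf mulr0 if_same subr0 /f /twist.
  rewrite setTD setCK => H; apply/esym.
  have := congr1 (fun x => twist_sgn setT (~: s) * x) (H _).
  rewrite /= !mulrA twist_sgn_sqr !mul1r; apply => q.
  by rewrite subsetT.
rewrite /untwist subsetT setTD /cone inE /f /twist => /orP[->|/eqP cu].
  by rewrite mulr0.
case: ifP; rewrite ?mulr0 // => _; rewrite (_ : _ :\: _ = s :\ u) ?cu ?mulr0 //.
by apply/setP=> v; rewrite !inE andbT negb_or negbK.
Qed.
End Twist.

(** * Multigraded components of Koszul chains *)

Section Koszul.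
Variables (n : nat) (k : fieldType).
Local Notation S := {mpoly k[n]}.
Implicit Types (z y : {set 'I_n} -> S) (c e : {set 'I_n} -> k).
Implicit Types (s W : {set 'I_n}) (u v : 'I_n) (a b : 'X_{1..n}).

Definition koszul_diff z s : S :=
  \sum_(v | v \notin s) sgn S v s * ('X_v * z (v |: s)).

Lemma mcoeffXUM v (p : S) b :
  ('X_v * p)@_b = if (0 < b v)%N then p@_(b - U_(v))%MM else 0.
Proof.
rewrite mulrC; case: ifPn => bv.
  have vb : (U_(v) <= b)%MM.
    by apply/mnm_lepP => i; rewrite mnm1E; case: eqVneq => [<-|].
  by rewrite -{1}(submK vb) addmC mcoeffMX.
apply/eqP; rewrite mcoeff_eq0; apply: contra bv.
rewrite (perm_mem (msuppMX _ _)) => /mapP[m' _ ->].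
by rewrite mnmDE mnm1E eqxx.
Qed.

Lemma mcoeff_sgn v s (p : S) b : (sgn S v s * p)@_b = sgn k v s * p@_b.
Proof.
rewrite /sgn -signr_odd -[in RHS]signr_odd; case: odd;
  rewrite ?expr0 ?expr1 ?mul1r //.
by rewrite !mulN1r mcoeffN.
Qed.

(* The multigraded component of degree [a] of a Koszul chain. *)
Definition component a z s : k :=
  if (mesym1 s <= a)%MM then (z s)@_(a - mesym1 s)%MM else 0.

Lemma mesym1U v s : v \notin s -> (mesym1 (v |: s) = U_(v) + mesym1 s)%MM.
Proof.
move=> vs; apply/mnmP => i; rewrite mnmDE mnm1E !mnmE !inE eq_sym.
by case: eqVneq => [<-|] //=; rewrite (negPf vs).
Qed.

Lemma component_koszul_diff a z s :
  component a (koszul_diff z) s = chbd (component a z) s.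
Proof.
rewrite /component /koszul_diff /chbd; case: ifPn => sa.
  rewrite raddf_sum; apply: eq_bigr => v vs; rewrite /= mcoeff_sgn mcoeffXUM.
  congr (_ * _); rewrite mesym1U // mnmBE mnmE (negPf vs) subn0.
  have -> : (U_(v) + mesym1 s <= a)%MM = (0 < a v)%N.
    apply/mnm_lepP/idP => [/(_ v)|av i]; rewrite mnmDE mnm1E.
      by rewrite eqxx; apply: leq_trans.
    case: eqVneq => [<-|_]; first by rewrite mnmE (negPf vs).
    exact: (mnm_lepP sa i).
  case: ifP => // _; congr (_@_ _).
  by apply/mnmP => i; rewrite !(mnmBE, mnmDE) subnDA subnAC.
rewrite big1 // => v vs; rewrite ifN ?mulr0 //; apply: contra sa.
rewrite mesym1U // => /mnm_lepP h; apply/mnm_lepP => i.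
by apply: leq_trans (h i); rewrite mnmDE leq_addl.
Qed.

Lemma componentP z y :
  (forall a s, component a z s = component a y s) -> forall s, z s = y s.
Proof.
move=> H s; apply/mpolyP => b; have := H (b + mesym1 s)%MM s.
by rewrite /component lem_addl addmK.
Qed.

(** The degree bound leaves finitely many components, so that each polynomial is a finite sum over
    truncated exponents. *)
Lemma assemble (e : 'X_{1..n} -> {set 'I_n} -> k) (d : nat) :
    (forall a s, (d <= mdeg a)%N -> e a s = 0) ->
    (forall a s, ~~ (mesym1 s <= a)%MM -> e a s = 0) ->
  exists y, forall a s, component a y s = e a s.
Proof.
move=> ed em.
exists (fun s =>
  \sum_(b : 'X_{1..n < d}) e (b + mesym1 s)%MM s *: 'X_[b]) => a s.
rewrite /component; case: ifPn => [sa|/em-> //].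
rewrite -[in RHS](submK sa); set b := (a - mesym1 s)%MM.
case: (ltnP (mdeg b) d) => [bd|db].
  by rewrite (mcoeff_mpoly (fun b => e (b + mesym1 s)%MM s)).
rewrite ed; last by rewrite mdegD (leq_trans db) ?leq_addr.
rewrite raddf_sum big1 // => -[b' b'd] _ /=; rewrite mcoeffZ mcoeffX.
by case: eqVneq => [E|]; rewrite ?mulr0 //; move: b'd; rewrite E ltnNge db.
Qed.

Lemma component_bound z : exists d, forall a s, (d <= mdeg a)%N ->
  component a z s = 0.
Proof.
(* The summand [n] bounds the degree of [mesym1 s]. *)
exists (\max_(s : {set 'I_n}) msize (z s) + n)%N => a s da; rewrite /component.
case: ifP => // sa; apply: memN_msupp_eq0; apply/negP => /msize_mdeg_lt.
rewrite ltnNge (leq_trans (leq_bigmax (F := fun s => msize (z s)) s)) //.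
rewrite -(leq_add2r n) (leq_trans da) // -{1}(submK sa) mdegD leq_add2l.
by rewrite mdeg_mesym1 -[X in (_ <= X)%N]card_ord max_card.
Qed.

(* [P] selects the monomials of a monomial ideal. *)
Lemma koszul_exact_components (P : pred 'X_{1..n}) z :
    (forall a, exists2 e,
       forall s, ~~ ((mesym1 s <= a)%MM && P (a - mesym1 s)%MM) -> e s = 0 &
       forall s, chbd e s = component a z s) ->
  exists2 y, forall s b, ~~ P b -> (y s)@_b = 0 &
             forall s, koszul_diff y s = z s.
Proof.
move=> H; have [d dz] := component_bound z.
pose good a e := (forall s,
  ~~ ((mesym1 s <= a)%MM && P (a - mesym1 s)%MM) -> e s = 0) /\
  (forall s, chbd e s = component a z s).
pose e a := epsilon (inhabits (fun=> 0)) (good a).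
have goode a : good a (e a).
  by apply: epsilon_spec; case: (H a) => e' e0 eE; exists e'.
(* The chosen [e a] may be nonzero in infinitely many degrees. From [d] on, where [z] has no
   component, 0 serves as well and lets [assemble] apply. *)
pose e' a s := if (d <= mdeg a)%N then 0 else e a s.
have e'0 a s : ~~ ((mesym1 s <= a)%MM && P (a - mesym1 s)%MM) -> e' a s = 0.
  by rewrite /e'; case: ifP => // _; apply: (goode a).1.
have [a s da|a s sa|y yE] := @assemble e' d; first by rewrite /e' da.
  by rewrite e'0 // (negPf sa).
exists y => [s b Pb|].
  have := yE (b + mesym1 s)%MM s; rewrite /component lem_addl addmK => ->.
  by rewrite e'0 // addmK (negPf Pb) andbF.
apply: componentP => a s; rewrite component_koszul_diff.
rewrite /chbd; under eq_bigr => v _ do rewrite yE /e'.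
case: (leqP d (mdeg a)) => da; last exact: (goode a).2.
by rewrite dz // big1 // => v _; rewrite mulr0.
Qed.

Definition monochain a c s : S :=
  if (mesym1 s <= a)%MM then c s *: 'X_[a - mesym1 s] else 0.

Lemma component_monochain a c b s :
    (forall s, ~~ (mesym1 s <= a)%MM -> c s = 0) ->
  component b (monochain a c) s = if b == a then c s else 0.
Proof.
move=> c0; rewrite /component /monochain.
case: (boolP (mesym1 s <= a)%MM) => sa; last by rewrite c0 // mcoeff0 !if_same.
rewrite mcoeffZ mcoeffX; case: ifPn => sb.
  have -> : (a - mesym1 s == b - mesym1 s)%MM = (b == a).
    apply/eqP/eqP => [E|->//].
    by rewrite -(submK sa) -(submK sb) E.
  by case: eqP; rewrite ?mulr1 ?mulr0.
by case: eqP sb => // ->; rewrite sa.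
Qed.

Lemma koszul_diff_monochain a c :
    (forall s, ~~ (mesym1 s <= a)%MM -> c s = 0) ->
    (forall s, chbd c s = 0) ->
  forall s, koszul_diff (monochain a c) s = 0.
Proof.
move=> c0 cc; apply: (@componentP _ (fun=> 0)) => b s.
rewrite component_koszul_diff [RHS]/component mcoeff0 if_same.
have [->|ba] := eqVneq b a.
  rewrite -[RHS](cc s); apply: eq_bigr => v _.
  by rewrite component_monochain // eqxx.
by rewrite /chbd big1 // => v _;
  rewrite component_monochain // (negPf ba) mulr0.
Qed.

Lemma component_cycle z a : (forall s, koszul_diff z s = 0) ->
  forall s, chbd (component a z) s = 0.
Proof.
by move=> zc s; rewrite -component_koszul_diff /component zc mcoeff0 if_same.
Qed.

(* Applied to a variable [u] whose exponent in [a] exceeds 1: the condition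
   [P (a - mesym1 s)] then does not depend on whether [u] belongs to [s], and
   the contraction along [u] preserves it. *)
Lemma component_contract (P : pred 'X_{1..n}) z a u :
    (forall s, koszul_diff z s = 0) -> (forall s b, ~~ P b -> (z s)@_b = 0) ->
    (forall s, u \in s -> (mesym1 (s :\ u) <= a)%MM ->
      P (a - mesym1 (s :\ u))%MM ->
       (mesym1 s <= a)%MM && P (a - mesym1 s)%MM) ->
  exists2 e,
    forall s, ~~ ((mesym1 s <= a)%MM && P (a - mesym1 s)%MM) -> e s = 0 &
    forall s, chbd e s = component a z s.
Proof.
move=> zc zP closed.
have [e eE e0] := chbd_contract u (component_cycle a zc).
exists e => // s sP; apply: e0; case: (boolP (u \in s)) => //= us.
rewrite /component; case: ifP => // sa; rewrite zP //.
by apply: contra sP => /(closed s us sa).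
Qed.

(** In a nonzero multidegree, contract along a variable that occurs in it. In multidegree 0 only the
    constant term of [z set0] is left, which is 0 by hypothesis. *)
Lemma koszul_exact z :
    (forall s, koszul_diff z s = 0) -> (z set0)@_0%MM = 0 ->
  exists y, forall s, koszul_diff y s = z s.
Proof.
move=> zc z0.
have [a|y _ yE] := @koszul_exact_components predT z; last by exists y.
have [->|] := eqVneq a 0%MM.
  exists (fun=> 0) => // s; rewrite /chbd big1 => [|v _]; last by rewrite mulr0.
  rewrite /component; case: ifP => // /mnm_lepP s0.
  suff -> : s = set0.
    by rewrite (_ : _ - _ = 0)%MM ?z0 //; apply/mnmP => i; rewrite mnmBE mnm0E.
  by apply/setP => i; have := s0 i; rewrite mnmE mnm0E inE; case: (i \in s).
rewrite -mdeg_eq0 mdegE sum_nat_eq0 negb_forall => /existsP[u /= au].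
apply: (@component_contract predT z a u) => // s us /mnm_lepP sa _.
rewrite andbT.
apply/mnm_lepP => i; have := sa i; rewrite !mnmE !inE.
by case: eqVneq => [->|]; rewrite ?us //= lt0n au.
Qed.
End Koszul.

(** * Hochster's formula *)

Section Hochster.
Variables (n : nat) (k : fieldType) (G : graph n).
Local Notation S := {mpoly k[n]}.
Implicit Types (z y : {set 'I_n} -> S) (c e : {set 'I_n} -> k).
Implicit Types (s W : {set 'I_n}) (u v : 'I_n) (a b : 'X_{1..n}).

Definition supp b : {set 'I_n} := [set i | (0 < b i)%N].

(** By [nonedge_idealP] these are the monomials of the non-edge ideal. *)
Definition nonclique_mon b : bool := ~~ clique G (supp b).

(* The nonvanishing of the Koszul homology of the ideal spanned by the
   monomials [nonclique_mon] in homological degree [p] and internal degree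
   [p + q]. *)
Definition koszul_nonzero p q : Prop :=
  exists z,
    [/\ forall s b, ~~ nonclique_mon b -> (z s)@_b = 0,
        forall s, #|s| <> p -> z s = 0,
        forall s, z s \is q.-homog,
        forall s, koszul_diff z s = 0
      & ~ exists2 y, forall s b, ~~ nonclique_mon b -> (y s)@_b = 0 &
                     forall s, koszul_diff y s = z s].

Lemma mesym1_le s W : (mesym1 s <= mesym1 W)%MM = (s \subset W).
Proof.
apply/mnm_lepP/subsetP => [h i|h i].
  by have := h i; rewrite !mnmE; case: (i \in s) => //; case: (i \in W).
by rewrite !mnmE; case: (boolP (i \in s)) => // /h ->.
Qed.

Lemma mesym1B s W : s \subset W -> (mesym1 W - mesym1 s = mesym1 (W :\: s))%MM.
Proof.
move/subsetP => sW; apply/mnmP => i; rewrite mnmBE !mnmE !inE.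
by case: (boolP (i \in s)) => [/sW->|_] //; rewrite subn0.
Qed.

Lemma supp_mesym1 s : supp (mesym1 s) = s.
Proof. by apply/setP => i; rewrite inE mnmE; case: (i \in s). Qed.

(** Multidegrees that are not squarefree are contracted by [component_contract]. In the multidegree
    of [W], [twist] exchanges [s] with [W :\: s]: the monomial at [s] lies in the ideal exactly if
    [W :\: s] is not a clique, so chains become relative cochains. *)
Lemma hochster p q :
  koszul_nonzero p q <-> exists2 W : {set 'I_n}, #|W| = (p + q)%N &
    ~ rel_acyclic k G W q.
Proof.
split=> [[z [zP zp zq zc zN]]|[W Wpq Wq]].
  apply: NNPP => NW; apply: zN; apply: koszul_exact_components => a.
  have [->|] := eqVneq a (mesym1 (supp a)); last first.
    move=> aN; have [u au] : exists u, (1 < a u)%N.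
      apply: NNPP => au; case/eqP: aN; apply/mnmP => i; rewrite mnmE inE.
      by case: (ltngtP 1 (a i)) => [ai|/=|<-//];
        [case: au; exists i|case: (a i)].
    apply: (@component_contract _ _ nonclique_mon z a u zc zP) => s us sa Ps.
    have sa' : (mesym1 s <= a)%MM.
      apply/mnm_lepP => i; have := mnm_lepP sa i; rewrite !mnmE !inE.
      by case: eqVneq => [->|] //=; rewrite us (ltnW au).
    rewrite sa' /=; move: Ps;
      rewrite /nonclique_mon (_ : supp _ = supp (a - mesym1 s)) //.
    apply/setP => i; rewrite !inE !mnmBE !mnmE !inE.
    by case: eqVneq => [->|] //=; rewrite us subn0 subn_gt0 au (ltnW au).
  set W := supp a.
  pose c := component (mesym1 W) z.
  have c0 s : ~~ (s \subset W) -> c s = 0.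
    by rewrite /c /component mesym1_le => /negPf->.
  have cp s : #|s| != p -> c s = 0.
    by move=> /eqP sp; rewrite /c /component zp // mcoeff0 if_same.
  have cc s : chbd c s = 0 by apply: component_cycle.
  have [[s0 cs0]|cN] := classic (exists s, c s <> 0); last first.
    exists (fun=> 0) => // s; rewrite /chbd big1 => [|v _];
      last by rewrite mulr0.
    by apply/esym; apply: NNPP => cs; apply: cN; exists s.
  have s0W : s0 \subset W by apply: contraT => /c0.
  have s0p : #|s0| = p by apply/eqP; apply: contraT => /cp.
  have Wpq : #|W| = (p + q)%N.
    move: cs0; rewrite /c /component mesym1_le s0W => /eqP cs0.
    have := dhomogP _ _ _ (zq s0) (mesym1 W - mesym1 s0)%MM.
    rewrite mcoeff_msupp cs0 => /(_ isT) <-;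
      rewrite -s0p -!mdeg_mesym1 addnC -mdegD submK //.
    by rewrite mesym1_le.
  have HW : rel_acyclic k G W q by apply: NNPP => h; apply: NW; exists W.
  have [r rW rcl|r rW rq|g g0 gE] := HW (twist W c).
  - rewrite /twist /c /component mesym1_le subsetDl zP ?mulr0 //.
    by rewrite /nonclique_mon negbK mesym1B ?subsetDl // setDDK // supp_mesym1.
  - by rewrite cobd_twist // cc mulr0.
  (* The coboundary of [g] is controlled in cardinality [q] only; the sets that enter it have
     complements in [W] with [p.+1] elements. *)
  exists (fun s => if #|s| == p.+1 then untwist W g s else 0) => s.
    rewrite mesym1_le /untwist; case: ifP => // _; case: ifP => //= sW.
    by rewrite mesym1B // /nonclique_mon negbK supp_mesym1 => /g0->;
      rewrite ?subsetDl ?mulr0.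
  rewrite -/c; have [sp|sp] := eqVneq #|s| p; last first.
    rewrite cp // chbd_eq0 // => v vs.
    by rewrite cardsU1 vs eqSS (negPf sp).
  case: (boolP (s \subset W)) => sW; last first.
    rewrite c0 // chbd_eq0 // => v vs.
    by rewrite /untwist subUset (negPf sW) andbF if_same.
  rewrite (@eq_chbd _ _ _ (untwist W g)) => [|v vs]; last first.
    by rewrite cardsU1 vs sp eqxx.
  apply: (@twist_sgn_inj _ _ W (W :\: s)); rewrite /= -cobd_untwist // -gE.
  - by rewrite /twist setDDK.
  - exact: subsetDl.
  by rewrite cardsDS // Wpq sp addKn.
apply: NNPP => zN; apply: Wq => f f0 cf; apply: NNPP => gN; apply: zN.
pose c s := if #|s| == p then untwist W f s else 0.
have c0 s : ~~ (s \subset W) -> c s = 0.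
  by rewrite /c /untwist => /negPf->; rewrite if_same.
have c0' s : ~~ (mesym1 s <= mesym1 W)%MM -> c s = 0.
  by rewrite mesym1_le => /c0.
exists (monochain (mesym1 W) c); split.
- move=> s b; rewrite /nonclique_mon negbK /monochain mesym1_le => cb.
  case: ifP => sW; last by rewrite mcoeff0.
  rewrite mcoeffZ mcoeffX mesym1B //; case: eqP => [E|]; rewrite ?mulr0 //.
  rewrite /c /untwist sW f0 ?subsetDl ?mulr0 ?if_same ?mul0r //.
  by rewrite -(supp_mesym1 (W :\: s)) E.
- by move=> s /eqP/negPf sp; rewrite /monochain /c sp scale0r if_same.
- move=> s; rewrite /monochain mesym1_le; case: ifP => sW; last exact: dhomog0.
  rewrite /c; case: eqP => sp; last by rewrite scale0r dhomog0.
  apply: dhomogZ; rewrite dhomogX mesym1B //= mdeg_mesym1 cardsDS //.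
  by rewrite Wpq sp addKn.
- apply: koszul_diff_monochain => // s.
  case: (boolP (s \subset W)) => sW; last first.
    by apply: chbd_eq0 => v vs; rewrite c0 // subUset (negPf sW) andbF.
  have [sp|sp] := eqVneq #|s|.+1 p; last first.
    by apply: chbd_eq0 => v vs; rewrite /c cardsU1 vs (negPf sp).
  rewrite (@eq_chbd _ _ _ (untwist W f)) => [|v vs]; last first.
    by rewrite /c cardsU1 vs add1n sp eqxx.
  apply: (@twist_sgn_inj _ _ W (W :\: s));
    rewrite /= -cobd_untwist // mulr0 cf ?subsetDl //.
  by rewrite cardsDS // Wpq -sp addSnnS addKn.
move=> [y yP yE]; apply: gN;
  exists (twist W (component (mesym1 W) y)) => [r rW cr|r rW rq].
  rewrite /twist /component mesym1_le subsetDl yP ?mulr0 //.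
  by rewrite /nonclique_mon negbK mesym1B ?subsetDl // setDDK // supp_mesym1.
rewrite cobd_twist // => [|s sW];
  last by rewrite /component mesym1_le (negPf sW).
rewrite -component_koszul_diff /component yE -/(component _ _ _)
  component_monochain //.
rewrite eqxx /c /untwist cardsDS // Wpq rq addnK eqxx subsetDl setDDK //.
by rewrite mulrA twist_sgn_sqr mul1r.
Qed.
End Hochster.

(** * Koszul homology of graded modules *)

Section Graded.
Variables (n : nat) (k : fieldType).
Local Notation S := {mpoly k[n]}.

Lemma pihomogM (p q : S) d e : q \is e.-homog ->
  pihomog mdeg (d + e) (p * q) = pihomog mdeg d p * q.
Proof.
move=> qe.
have := pihomog_partitionE (mf := mdeg) (leq_addr d.+1 (mmeasure mdeg p)).
set N := (_ + _)%N => pE; rewrite {1}pE mulr_suml raddf_sum /=.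
have dN : (d < N)%N by rewrite /N leq_addl.
rewrite (bigD1 (Ordinal dN)) //= big1 ?addr0 => [|i id].
  by rewrite pihomog_dE // dhomogM // pihomogP.
apply: (pihomog_ne0 (d := (i + e)%N)); last by rewrite dhomogM // pihomogP.
by rewrite eqn_add2r; apply: contra id => /eqP E; apply/eqP/val_inj.
Qed.

Lemma pihomogM_lt (p q : S) d e : q \is e.-homog -> (d < e)%N ->
  pihomog mdeg d (p * q) = 0.
Proof.
move=> qe de; rewrite [p](pihomog_partitionE (mf := mdeg) (leqnn _)).
rewrite mulr_suml raddf_sum /= big1 // => i _.
apply: (pihomog_ne0 (d := (i + e)%N)); last by rewrite dhomogM // pihomogP.
by rewrite neq_ltn (leq_trans de) ?leq_addl ?orbT.
Qed.

Lemma X_homog (v : 'I_n) : ('X_v : S) \is 1.-homog.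
Proof. by rewrite dhomogX /= mdeg1. Qed.

Lemma coef0_homog (p : S) d : p \is d.+1.-homog -> p@_0%MM = 0.
Proof. by move/dhomog_nemf_coeff; apply; rewrite /= mdeg0. Qed.

Lemma coef0XM (v : 'I_n) (p : S) : ('X_v * p)@_0%MM = 0.
Proof. by rewrite mcoeffXUM mnm0E. Qed.

Section Module.
Variables (l : nat) (d : 'I_l -> nat).
Implicit Types (v w : 'rV[S]_l).

Definition ghomog j v : Prop := forall a, homog_diff j (d a) (v 0 a).

Definition hproj j v : 'rV[S]_l :=
  \row_a (if (d a <= j)%N then pihomog mdeg (j - d a) (v 0 a) else 0).

(** Membership in m F, where m is the ideal of the variables and F the free module. *)
Definition constfree v : Prop := forall a, (v 0 a)@_0%MM = 0.

Lemma ghomog0 j : ghomog j 0.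
Proof. by move=> a; rewrite /homog_diff mxE eqxx. Qed.

Lemma hproj_homog j v : ghomog j (hproj j v).
Proof.
move=> a; rewrite /homog_diff mxE; case: leqP; rewrite ?eqxx //= => _.
by rewrite pihomogP orbT.
Qed.

Lemma hproj_id j v : ghomog j v -> hproj j v = v.
Proof.
move=> hv; apply/rowP => a; rewrite mxE;
  case/orP: (hv a) => [/eqP->|/andP[-> va]].
  by rewrite raddf0 if_same.
by rewrite pihomog_dE.
Qed.

Lemma hproj_is_additive j : zmod_morphism (hproj j).
Proof.
move=> v w; apply/rowP => a; rewrite !mxE; case: ifP => _;
  last by rewrite subr0.
exact: raddfB.
Qed.
HB.instance Definition _ j :=
  GRing.isZmodMorphism.Build 'rV[S]_l 'rV[S]_l (hproj j) (hproj_is_additive j).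

Lemma hproj_XM j x v : hproj j.+1 ('X_x *: v) = 'X_x *: hproj j v.
Proof.
apply/rowP => a; rewrite !mxE ![ 'X_x * _]mulrC; case: (leqP (d a) j) => aj.
  by rewrite leqW // subSn // -addn1 pihomogM // X_homog.
rewrite mul0r; case: leqP => // aj1.
have -> : (j.+1 - d a = 0)%N by apply/eqP; rewrite subn_eq0.
by rewrite (pihomogM_lt _ (X_homog x)).
Qed.

Lemma hproj0_XM x v : hproj 0 ('X_x *: v) = 0.
Proof.
apply/rowP => a; rewrite !mxE mulrC; case: leqP => // _.
by rewrite sub0n (pihomogM_lt _ (X_homog x)).
Qed.

Lemma hproj_sum v : exists N, v = \sum_(j < N) hproj j v.
Proof.
exists (\max_a (d a + mmeasure mdeg (v 0%R a)))%N; apply/rowP => a.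
set N := (\max_a _)%N; have aN : (d a + mmeasure mdeg (v 0%R a) <= N)%N.
  exact: (leq_bigmax (F := fun a => (d a + mmeasure mdeg (v 0%R a))%N)).
rewrite summxE.
under eq_bigr => j _ do rewrite mxE.
rewrite -(big_mkord predT (fun j =>
  if (d a <= j)%N then pihomog mdeg (j - d a) (v 0 a) else 0)).
have dN : (d a <= N)%N by apply: leq_trans aN; rewrite leq_addr.
rewrite (big_cat_nat (n := d a)) //= big_nat big1 ?add0r => [|j /andP[_ ja]];
  last first.
  by rewrite leqNgt ja.
rewrite -{1}[d a]add0n big_addn big_mkord.
under eq_bigr => j _ do rewrite leq_addl addnK.
by rewrite -pihomog_partitionE // leq_subRL //.
Qed.

Definition koszul (z : {set 'I_n} -> 'rV[S]_l) (s : {set 'I_n}) : 'rV[S]_l :=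
  \sum_(v | v \notin s) sgn S v s *: ('X_v *: z (v |: s)).

Implicit Types (z y : {set 'I_n} -> 'rV[S]_l) (s : {set 'I_n}).

Lemma koszul_col z s a : koszul z s 0 a = koszul_diff (fun r => z r 0 a) s.
Proof. by rewrite /koszul summxE; apply: eq_bigr => v _; rewrite !mxE. Qed.

Lemma eq_koszul z y s :
    (forall v : 'I_n, v \notin s -> z (v |: s) = y (v |: s)) ->
  koszul z s = koszul y s.
Proof. by move=> zy; apply: eq_bigr => v /zy->. Qed.

Lemma koszulB z y s : koszul (fun r => z r - y r) s = koszul z s - koszul y s.
Proof. by rewrite /koszul -sumrB; apply: eq_bigr => v _; rewrite !scalerBr. Qed.

Lemma koszul_eq0 z s : (forall v : 'I_n, v \notin s -> z (v |: s) = 0) ->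
  koszul z s = 0.
Proof. by move=> z0; apply: big1 => v /z0->; rewrite !scaler0. Qed.

Lemma koszul_constfree z s : constfree (koszul z s).
Proof.
move=> a; rewrite koszul_col /koszul_diff raddf_sum big1 // => v _ /=.
by rewrite mcoeff_sgn coef0XM mulr0.
Qed.

Lemma koszul_koszul z s : koszul (koszul z) s = 0.
Proof.
pose T (u v : 'I_n) : 'rV[S]_l := sgn S v s *: ('X_v *: (sgn S u (v |: s) *:
  ('X_u *: z (u |: (v |: s))))).
rewrite -[RHS](@sum_antisym n _ (fun v : 'I_n => v \notin s) T) /T; last first.
  move=> u v uv us vs; rewrite !scalerA setUCA -scaleNr; congr (_ *: _).
  have := @sgn_anticomm n S v u s;
    rewrite eq_sym uv us vs => /(_ isT isT isT) E.
  transitivity (sgn S u (v |: s) * sgn S v s * ('X_v * 'X_u)); first by ring.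
  by rewrite E; ring.
apply: eq_bigr => v vs; rewrite /koszul !scaler_sumr.
by apply: eq_bigl => u; rewrite !inE negb_or andbC.
Qed.

Lemma hproj_sgn j (v : 'I_n) s w :
  hproj j (sgn S v s *: w) = sgn S v s *: hproj j w.
Proof.
rewrite /sgn -signr_odd; case: odd; rewrite ?expr0 ?expr1 ?scale1r //.
by rewrite !scaleN1r raddfN.
Qed.

Lemma hproj_koszul j z s :
  hproj j.+1 (koszul z s) = koszul (fun r => hproj j (z r)) s.
Proof.
rewrite /koszul raddf_sum; apply: eq_bigr => v _.
by rewrite /= hproj_sgn hproj_XM.
Qed.

Lemma hproj0_koszul z s : hproj 0 (koszul z s) = 0.
Proof.
rewrite /koszul raddf_sum big1 // => v _.
by rewrite /= hproj_sgn hproj0_XM scaler0.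
Qed.

Lemma free_koszul_exact z : (forall s, koszul z s = 0) -> constfree (z set0) ->
  exists y, forall s, koszul y s = z s.
Proof.
move=> zc z0.
have /fin_all_exists[f fE] (a : 'I_l) : exists y : {set 'I_n} -> S,
    forall s, koszul_diff y s = z s 0 a.
  by apply: koszul_exact => [s|]; rewrite ?z0 // -koszul_col zc mxE.
exists (fun s => \row_a f a s) => s; apply/rowP => a.
by rewrite koszul_col -fE; apply: eq_bigr => v _; rewrite mxE.
Qed.

(* Nonvanishing of the Koszul homology of the submodule [N] in homological
   degree [p] and internal degree [p + q]. *)
Definition koszul_homology_ne0 (N : 'rV[S]_l -> Prop) p q : Prop :=
  exists z,
    [/\ forall s, N (z s),
        forall s, #|s| <> p -> z s = 0,
        forall s, ghomog q (z s),
        forall s, koszul z s = 0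
      & ~ exists2 y, forall s, N (y s) & forall s, koszul y s = z s].

End Module.
End Graded.

(** * Dimension shift along a map of free modules *)

Section Shift.
Variables (n : nat) (k : fieldType) (m l : nat).
Local Notation S := {mpoly k[n]}.
Variables (dm : 'I_m -> nat) (dl : 'I_l -> nat) (A : 'M[S]_(m, l)).

Definition graded_mx : Prop := forall a b, homog_diff (dm a) (dl b) (A a b).

Definition im_mx (v : 'rV[S]_l) : Prop := exists w, v = w *m A.

Definition ker_mx (v : 'rV[S]_m) : Prop := v *m A = 0.

Hypothesis grA : graded_mx.

Lemma hproj_mulmx j (v : 'rV[S]_m) : hproj dl j (v *m A) = hproj dm j v *m A.
Proof.
apply/rowP => c; rewrite !mxE raddf_sum.
transitivity (\sum_a
  if (dl c <= j)%N then pihomog mdeg (j - dl c) (v 0 a * A a c) else 0).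
  by case: ifP => // _; rewrite big1.
apply: eq_bigr => a _; rewrite mxE.
case/orP: (grA a c) => [/eqP->|/andP[ca Aac]].
  by rewrite !mulr0 raddf0 if_same.
case: (leqP (dm a) j) => aj.
  rewrite (leq_trans ca aj) -(pihomogM _ _ Aac) //; congr (pihomog _ _ _).
  by rewrite addnBA // subnK.
rewrite mul0r; case: leqP => // cj; rewrite (pihomogM_lt _ Aac) //.
by rewrite ltn_sub2r // (leq_ltn_trans cj).
Qed.

Lemma koszul_mulmx z s : koszul (fun r => z r *m A) s = koszul z s *m A.
Proof.
rewrite /koszul mulmx_suml; apply: eq_bigr => v _.
by rewrite -!scalemxAl.
Qed.

Lemma im_mx_lift (z : {set 'I_n} -> 'rV[S]_l) : (forall s, im_mx (z s)) ->
  exists w, forall s, z s = w s *m A.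
Proof. by move=> /fin_all_exists. Qed.

Lemma im_mxP_homog j v : im_mx v -> ghomog dl j v ->
  exists2 w, v = w *m A & ghomog dm j w.
Proof.
move=> [w ->] /hproj_id; rewrite hproj_mulmx => E.
by exists (hproj dm j w) => //; apply: hproj_homog.
Qed.

Hypothesis kerA : forall v, ker_mx v -> constfree v.

(* The connecting map of the long exact sequence of Koszul homology, which is
   an isomorphism as free modules are acyclic and the kernel of [A] has no
   constant entries. *)
Lemma koszul_shift p q :
  koszul_homology_ne0 dl im_mx p.+1 q <-> koszul_homology_ne0 dm ker_mx p q.+1.
Proof.
split=> [[z [zA zp zq zc zN]]|[y [yA yp yq yc yN]]].
  have [w0 w0E] := im_mx_lift zA.
  pose w (s : {set 'I_n}) := if #|s| == p.+1 then hproj dm q (w0 s) else 0.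
  have wE s : z s = w s *m A.
    rewrite /w; case: eqP => [_|/zp->]; last by rewrite mul0mx.
    by rewrite -hproj_mulmx -w0E hproj_id.
  exists (koszul w); split.
  - by move=> s; rewrite /ker_mx -koszul_mulmx -[RHS](zc s);
    apply: eq_koszul => v _.
  - move=> s sp; apply: koszul_eq0 => v vs.
    by rewrite /w cardsU1 vs add1n eqSS; case: eqP.
  - move=> s; rewrite (_ : koszul w s = hproj dm q.+1 (koszul w s));
    first exact: hproj_homog.
    rewrite hproj_koszul; apply: eq_koszul => v _; rewrite /w.
    by case: eqP; rewrite ?raddf0 // => _; apply/esym/hproj_id/hproj_homog.
  - exact: koszul_koszul.
  move=> [u uA uE]; apply: zN.
  (* If the boundary of [w] is also that of a chain [u] in the kernel, then [w - u] is a cycle of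
     the free module, hence a boundary, and [A] maps a primitive of it to a primitive of [z]. *)
  have [s|a|y yE] := @free_koszul_exact n k m (fun s => w s - u s).
  - by rewrite koszulB uE subrr.
  - by rewrite /w cards0 /= sub0r mxE mcoeffN (kerA (uA set0)) oppr0.
  exists (fun s => y s *m A) => s; first by exists (y s).
  by rewrite koszul_mulmx yE mulmxBl uA subr0 -wE.
have [w0 w0E] := free_koszul_exact yc (kerA (yA set0)).
pose w (s : {set 'I_n}) := if #|s| == p.+1 then hproj dm q (w0 s) else 0.
have wE s : koszul w s = y s.
  have [sp|sp] := eqVneq #|s| p; last first.
    rewrite yp; last exact/eqP.
    by apply: koszul_eq0 => v vs; rewrite /w cardsU1 vs add1n eqSS (negPf sp).
  rewrite -(hproj_id (yq s)) -w0E hproj_koszul; apply: eq_koszul => v vs.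
  by rewrite /w cardsU1 vs add1n eqSS sp eqxx.
exists (fun s => w s *m A); split.
- by move=> s; exists (w s).
- by move=> s /eqP/negPf sp; rewrite /w sp mul0mx.
- move=> s; rewrite /w; case: ifP => _; last by rewrite mul0mx; apply: ghomog0.
  by rewrite -hproj_mulmx; apply: hproj_homog.
- by move=> s; rewrite koszul_mulmx wE yA.
move=> [u uA uE]; apply: yN; have [u' u'E] := im_mx_lift uA.
exists (fun s => w s - koszul u' s) => s.
  rewrite /ker_mx mulmxBl -koszul_mulmx -uE.
  by apply/eqP; rewrite subr_eq0; apply/eqP/eq_koszul => v _.
by rewrite koszulB koszul_koszul subr0.
Qed.

Lemma koszul_homology0 (N : 'rV[S]_l -> Prop) j v :
    N v -> N 0 -> ghomog dl j v ->
    ~ (exists2 y, forall s, N (y s) & koszul y set0 = v) ->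
  koszul_homology_ne0 dl N 0 j.
Proof.
move=> Nv N0 vj vN; exists (fun s => if s == set0 then v else 0); split.
- by move=> s; case: ifP.
- by move=> s; case: eqP => // ->; rewrite cards0.
- by move=> s; case: ifP => // _; apply: ghomog0.
- move=> s; apply: koszul_eq0 => u us; case: eqP => // /setP/(_ u).
  by rewrite !inE eqxx.
by move=> [y yN yE]; apply: vN; exists y => //; rewrite yE eqxx.
Qed.

(** Koszul homology in homological degree 0 is the module modulo the ideal m of the variables, so it
    sees minimal generators. A basis vector is not a kernel vector plus a combination with
    coefficients in m, since its entry 1 is constant. In a degree without basis vectors, a
    homogeneous lift has its entries in m and so is a Koszul boundary. *)
Lemma degP j : (exists a, dm a = j) <-> koszul_homology_ne0 dl im_mx 0 j.
Proof.
split=> [[a aj]|[z [zA zp zq zc zN]]].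
  apply: (@koszul_homology0 _ _ (row a A)).
  - by exists (delta_mx 0 a); rewrite rowE.
  - by exists 0; rewrite mul0mx.
  - by move=> b; rewrite mxE -aj.
  move=> [y /im_mx_lift[w wE] yE].
  have /kerA/(_ a) : ker_mx (delta_mx 0 a - koszul w set0).
    rewrite /ker_mx mulmxBl -rowE -koszul_mulmx -yE; apply/eqP.
    by rewrite subr_eq0; apply/eqP/eq_koszul => v _; rewrite wE.
  rewrite !mxE !eqxx mcoeffB koszul_constfree subr0 mcoeff1 eqxx => /eqP.
  by rewrite oner_eq0.
apply: NNPP => jN; apply: zN.
have [w wE wj] := im_mxP_homog (zA set0) (zq set0).
have wcf : constfree w.
  move=> a; case/orP: (wj a) => [/eqP->|/andP[aj]]; first by rewrite mcoeff0.
  case E: (j - dm a)%N => [|e]; last exact: coef0_homog.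
  case: jN; exists a; apply/eqP; rewrite eqn_leq aj /=.
  by rewrite -subn_eq0 E.
have [s|a|y yE] :=
  @free_koszul_exact n k m (fun s => if s == set0 then w else 0).
- apply: koszul_eq0 => u us; case: eqP => // /setP/(_ u).
  by rewrite !inE eqxx.
- by rewrite eqxx.
exists (fun s => y s *m A) => s; first by exists (y s).
rewrite koszul_mulmx yE; case: eqP => [->//|s0]; rewrite mul0mx zp //.
by move/eqP; rewrite cards_eq0 => /eqP.
Qed.
End Shift.

(** * Minimal graded free resolutions *)

(** [U] is an arbitrary predicate, not assumed linear. A vector of [U] outside the row space is
    appended to [B]; each time the rank grows, so this ends after at most [m] times. *)
Lemma finite_span (k : fieldType) m (U : 'rV[k]_m -> Prop) :
  exists r (B : 'M[k]_(r, m)),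
    (forall i, U (row i B)) /\ forall u, U u -> (u <= B)%MS.
Proof.
suff H d r (B : 'M[k]_(r, m)) : (forall i, U (row i B)) ->
  (m - \rank B <= d)%N ->
  exists r (B : 'M[k]_(r, m)),
    (forall i, U (row i B)) /\ forall u, U u -> (u <= B)%MS.
  by apply: (H m 0%N 0) => [[]//|]; rewrite leq_subr.
elim: d r B => [|d IH] r B BU Bd.
  exists r, B; split=> // u _; apply: submx_full.
  by rewrite /row_full eqn_leq rank_leq_col -subn_eq0 -leqn0.
have [H|] := classic (forall u, U u -> (u <= B)%MS); first by exists r, B.
move=> H; have [u uP] := not_all_ex_not _ _ H.
have [Uu uB] := imply_to_and _ _ uP.
apply: (IH _ (col_mx B u)) => [i|].
  case: (splitP i) => j ij.
    by rewrite (_ : i = lshift 1 j) ?rowKu //; apply: val_inj.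
  by rewrite (_ : i = rshift r j) ?rowKd ?row_id //; apply: val_inj.
have lt : (\rank B < \rank (col_mx B u))%N.
  rewrite -addsmxE; apply: rank_ltmx; rewrite /ltmx addsmxSl /=.
  by apply/negP => /(submx_trans (addsmxSr _ _)).
have := rank_leq_col (col_mx B u); move: lt Bd.
set x := \rank B; set y := \rank _; lia.
Qed.

(** * Generators of graded submodules *)

Section Generators.
Variables (n : nat) (k : fieldType) (l : nat).
Local Notation S := {mpoly k[n]}.
Variable dl : 'I_l -> nat.

Lemma im_mx0 m (B : 'M[S]_(m, l)) : im_mx B 0.
Proof. by exists 0; rewrite mul0mx. Qed.

Lemma im_mxD m (B : 'M[S]_(m, l)) u v : im_mx B u -> im_mx B v ->
  im_mx B (u + v).
Proof. by move=> [w ->] [w' ->]; exists (w + w'); rewrite mulmxDl. Qed.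

Lemma im_mxZ m (B : 'M[S]_(m, l)) p v : im_mx B v -> im_mx B (p *: v).
Proof. by move=> [w ->]; exists (p *: w); rewrite scalemxAl. Qed.

Lemma im_mx_sum m (B : 'M[S]_(m, l)) (I : Type) (r : seq I) (P : pred I) F :
  (forall i, P i -> im_mx B (F i)) -> im_mx B (\sum_(i <- r | P i) F i).
Proof. by move=> BF; apply: big_ind => //; [apply: im_mx0 | apply: im_mxD]. Qed.

(** Entries of a vector of degree [j] have degree at most [j], so [phi] records it by finitely many
    coefficients, [psi] recovers it, and [finite_span] applies over [k]. *)
Lemma homog_piece_span (N : 'rV[S]_l -> Prop) j :
  exists r (B : 'M[S]_(r, l)),
    (forall i, N (row i B) /\ ghomog dl j (row i B)) /\
    forall v, N v -> ghomog dl j v -> im_mx B v.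
Proof.
pose T := ('I_l * 'X_{1..n < j.+1})%type.
pose ev (t : 'I_#|{: T}|) : T := enum_val t.
pose M : 'M[S]_(#|{: T}|, l) :=
  \matrix_(t, c) ('X_[(ev t).2] * ((ev t).1 == c)%:R).
pose psi (u : 'rV[k]_#|{: T}|) := map_mx (@mpolyC n k) u *m M.
pose phi (v : 'rV[S]_l) : 'rV[k]_#|{: T}| := \row_t (v 0 (ev t).1)@_(ev t).2.
have psiK v : ghomog dl j v -> psi (phi v) = v.
  move=> vj; apply/rowP => c; rewrite mxE.
  under eq_bigr => t _ do rewrite !mxE.
  have -> : \sum_t ((v 0 (ev t).1)@_(ev t).2)%:MP *
                 ('X_[(ev t).2] * ((ev t).1 == c)%:R) =
      \sum_(t : T) ((v 0 t.1)@_t.2)%:MP * ('X_[t.2] * (t.1 == c)%:R).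
    by rewrite [RHS](reindex ev) //; apply: onW_bij; apply: enum_val_bij.
  rewrite -(pair_bigA _ (fun a (b : 'X_{1..n < j.+1}) =>
    ((v 0 a)@_b)%:MP * ('X_[b] * (a == c)%:R))) /=.
  rewrite (bigD1 c) //= [X in _ + X]big1 ?addr0 => [|a ac]; last first.
    by apply: big1 => b _; rewrite (negPf ac) !mulr0.
  rewrite [RHS](mpolywE (k := j.+1)); last first.
    case/orP: (vj c) => [/eqP->|/andP[cj /dhomogP h]]; first by rewrite msize0.
    rewrite msizeE; apply/bigmax_leqP_seq => b bv _.
    by rewrite ltnS (h b bv) leq_subr.
  by apply: eq_bigr => b _; rewrite eqxx mulr1 mul_mpolyC.
have [r [B [BU Bspan]]] :=
  finite_span (fun u => N (psi u) /\ ghomog dl j (psi u)).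
exists r, (map_mx (@mpolyC n k) B *m M); split=> [i|v Nv vj].
  by rewrite row_mul -map_row; apply: BU.
have /submxP[D DE] : (phi v <= B)%MS by apply: Bspan; rewrite psiK.
by exists (map_mx (@mpolyC n k) D); rewrite mulmxA -map_mxM -DE -/(psi _) psiK.
Qed.

Record graded_submodule (N : 'rV[S]_l -> Prop) : Prop := GradedSubmodule {
  gsub0 : N 0;
  gsubD : forall u v, N u -> N v -> N (u + v);
  gsubZ : forall p v, N v -> N (p *: v);
  gsub_hproj : forall j v, N v -> N (hproj dl j v) }.

Lemma homog_pieces_span (N : 'rV[S]_l -> Prop) D :
  exists r (dr : 'I_r -> nat) (B : 'M[S]_(r, l)),
    [/\ graded_mx dr dl B, forall i, N (row i B) &
        forall j v, (j < D)%N -> N v -> ghomog dl j v -> im_mx B v].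
Proof.
elim: D => [|D [r1 [d1 [B1 [g1 N1 s1]]]]].
  by exists 0%N, (fun=> 0%N), 0; split=> [[]|[]|].
have [r2 [B2 [N2 s2]]] := homog_piece_span N D.
exists (r1 + r2)%N.
exists (fun i => match split i with inl a => d1 a | inr _ => D end).
exists (col_mx B1 B2).
split=> [i b|i|j v].
- rewrite mxE; case: (split i) => a; first exact: g1.
  by have [_ /(_ b)] := N2 a; rewrite mxE.
- case: (splitP i) => a ia.
    by rewrite (_ : i = lshift r2 a) ?rowKu //; apply: val_inj.
  rewrite (_ : i = rshift r1 a) ?rowKd; last exact: val_inj.
  by case: (N2 a).
rewrite ltnS leq_eqVlt => /orP[/eqP->|jD] Nv vj.
  have [w ->] := s2 v Nv vj; exists (row_mx 0 w).
  by rewrite mul_row_col mul0mx add0r.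
have [w ->] := s1 j v jD Nv vj; exists (row_mx w 0).
by rewrite mul_row_col mul0mx addr0.
Qed.

(** A graded Nakayama lemma. From degree [D] on, vanishing homology writes an element as a
    combination of variables times elements of [N], which may be taken one degree lower; induction
    on the degree reaches the pieces below [D]. *)
Lemma finitely_generated (N : 'rV[S]_l -> Prop) D :
    graded_submodule N ->
    (forall q, (D <= q)%N -> ~ koszul_homology_ne0 dl N 0 q) ->
  exists r (dr : 'I_r -> nat) (B : 'M[S]_(r, l)),
    graded_mx dr dl B /\ forall v, N v <-> im_mx B v.
Proof.
move=> [N0 ND NZ Nh] HD; have [r [dr [B [gB NB sB]]]] := homog_pieces_span N D.
exists r, dr, B; split=> // v; split=> [Nv|[w ->]]; last first.
  by rewrite mulmx_sum_row; apply: big_ind => // i _; apply: NZ.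
suff hom j u : N u -> ghomog dl j u -> im_mx B u.
  have [M ->] := hproj_sum dl v; apply: im_mx_sum => j _.
  by apply: (hom j); [apply: Nh | apply: hproj_homog].
elim/ltn_ind: j u => j IH u Nu uj.
case: (ltnP j D) => [jD|/HD NH]; first exact: (sB j).
have [y yN yE] : exists2 y, forall s, N (y s) & koszul y set0 = u.
  by apply: NNPP => H; apply: NH; apply: koszul_homology0 H.
rewrite -(hproj_id uj) -yE; case: j IH {NH uj} => [|j] IH.
  by rewrite hproj0_koszul; apply: im_mx0.
rewrite hproj_koszul; apply: im_mx_sum => x _; do 2!apply: im_mxZ.
by apply: (IH j) => //; [apply: Nh | apply: hproj_homog].
Qed.

Lemma pihomog0_const (p : S) : pihomog mdeg 0 p = (p@_0%MM)%:MP.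
Proof.
apply/mpolyP => b; rewrite mcoeffC; case: eqVneq => [->|b0]; last first.
  rewrite mulr0; apply: dhomog_nemf_coeff (pihomogP _ _ _) _.
  by rewrite /= mdeg_eq0.
rewrite mulr1.
rewrite [in RHS](pihomog_partitionE (mf := mdeg) (leqnSn (mmeasure mdeg p))).
rewrite big_ord_recl mcoeffD [X in _ + X]raddf_sum.
rewrite [X in _ + X]big1 ?addr0 //= => i _.
by rewrite (coef0_homog (d := i)) // pihomogP.
Qed.

(* A syzygy with a nonzero constant entry expresses a generator by the others;
   its part of the degree of that generator has a scalar entry there. *)
Lemma minimal_generators r (dr : 'I_r -> nat) (B : 'M[S]_(r, l)) :
    graded_mx dr dl B ->
  exists r' (dr' : 'I_r' -> nat) (B' : 'M[S]_(r', l)),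
    [/\ graded_mx dr' dl B', forall v, ker_mx B' v -> constfree v &
        forall v, im_mx B' v <-> im_mx B v].
Proof.
elim: r dr B => [|r IH] dr B gB.
  by exists 0%N, dr, B; split=> // v _ [].
have [H|] := classic (forall v, ker_mx B v -> constfree v).
  by exists r.+1, dr, B.
move=> H; have [v0 v0P] := not_all_ex_not _ _ H.
have [v0B v0N] := imply_to_and _ _ v0P; have [a v0a] := not_all_ex_not _ _ v0N.
pose v := hproj dr (dr a) v0.
have vB : v *m B = 0 by rewrite -(hproj_mulmx gB) v0B raddf0.
have va : v 0 a = ((v0 0 a)@_0%MM)%:MP.
  by rewrite mxE leqnn subnn pihomog0_const.
have va0 : (v0 0 a)@_0%MM != 0 by apply/eqP.
have rowa : row a B = - \sum_j (((v0 0 a)@_0%MM)^-1%:MP * v 0 (lift a j)) *: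
  row j (row' a B).
  move/(congr1 (fun w => (((v0 0 a)@_0%MM)^-1%:MP) *: w)): vB.
  rewrite mulmx_sum_row (bigD1_ord a) //= scaler0 scalerDr va scalerA.
  rewrite -rmorphM /= mulVf // scale1r => /eqP; rewrite addr_eq0 => /eqP->.
  congr (- _); rewrite scaler_sumr; apply: eq_bigr => j _; rewrite scalerA.
  congr (_ *: _); by apply/rowP => c; rewrite !mxE.
have [|r' [d' [B' [gB' kB' iB']]]] := IH (fun j => dr (lift a j)) (row' a B).
  by move=> i b; rewrite mxE.
exists r', d', B'; split=> // u; rewrite iB'; split=> [[w ->]|[w ->]];
  rewrite mulmx_sum_row.
  apply: im_mx_sum => j _; apply: im_mxZ; exists (delta_mx 0 (lift a j)).
  by rewrite -rowE; apply/rowP => c; rewrite !mxE.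
have rowP' j : im_mx (row' a B) (row j (row' a B)).
  by exists (delta_mx 0 j); rewrite -rowE.
rewrite (bigD1_ord a) //=; apply: im_mxD.
  rewrite rowa -scaleN1r; do 2!apply: im_mxZ; apply: im_mx_sum => j _.
  exact: im_mxZ.
apply: im_mx_sum => j _; apply: im_mxZ.
by have := rowP' j; rewrite (_ : row j _ = row (lift a j) B) //;
  apply/rowP => c; rewrite !mxE.
Qed.
End Generators.

(** * Construction of the resolution and its degrees *)

Section Resolution.
Variables (n : nat) (k : fieldType).
Local Notation S := {mpoly k[n]}.

Lemma eq_koszul_homology l (dl : 'I_l -> nat) (N N' : 'rV[S]_l -> Prop) p q :
    (forall v, N v <-> N' v) ->
  koszul_homology_ne0 dl N p q <-> koszul_homology_ne0 dl N' p q.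
Proof.
move=> NN'; split=> -[z [zN zp zq zc zb]]; exists z; split=> // [s|[y yN yE]];
  by [apply/NN' | apply: zb; exists y => // s; apply/NN'].
Qed.

Definition bounded_homology l (dl : 'I_l -> nat)
    (N : 'rV[S]_l -> Prop) : Prop :=
  forall p, exists D, forall q, (D <= q)%N -> ~ koszul_homology_ne0 dl N p q.

Lemma ker_graded_submodule m l (dm : 'I_m -> nat) (dl : 'I_l -> nat)
    (A : 'M[S]_(m, l)) :
  graded_mx dm dl A -> graded_submodule dm (ker_mx A).
Proof.
move=> gA; split=> [|u v uA vA|p v vA|j v vA]; rewrite /ker_mx.
- by rewrite mul0mx.
- by rewrite mulmxDl uA vA addr0.
- by rewrite -scalemxAl vA scaler0.
- by rewrite -(hproj_mulmx gA) vA raddf0.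
Qed.

(* One step of a minimal free resolution: a minimal graded presentation of the
   image of [step_mx]. *)
Record res_step l (dl : 'I_l -> nat) := ResStep {
  step_rank : nat;
  step_deg : 'I_step_rank -> nat;
  step_mx : 'M[S]_(step_rank, l);
  step_graded : graded_mx step_deg dl step_mx;
  step_minimal : forall v, ker_mx step_mx v -> constfree v;
  step_bounded : bounded_homology dl (im_mx step_mx) }.

Lemma res_step_exists l (dl : 'I_l -> nat) (N : 'rV[S]_l -> Prop) :
    graded_submodule dl N -> bounded_homology dl N ->
  exists s : res_step dl, forall v, im_mx (step_mx s) v <-> N v.
Proof.
move=> gN bN; have [D /(finitely_generated gN)[r [dr [B [gB NB]]]]] := bN 0%N.
have [r' [dr' [B' [gB' kB' iB']]]] := minimal_generators gB.
have imN v : im_mx B' v <-> N v by rewrite iB' NB.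
have bB' : bounded_homology dl (im_mx B').
  by move=> p; have [E EP] := bN p; exists E => q /EP;
    rewrite (eq_koszul_homology _ _ _ imN).
by exists (ResStep gB' kB' bB').
Qed.

(** The kernel has bounded homology, hence finitely many generators: by [koszul_shift] its bound in
    homological degree [p] is that of the image in degree [p.+1], enlarged by one. *)
Lemma next_step_exists l (dl : 'I_l -> nat) (s : res_step dl) :
  exists s' : res_step (@step_deg _ _ s),
    forall v, im_mx (step_mx s') v <-> ker_mx (step_mx s) v.
Proof.
case: s => r dr A gA kA bA /=; apply: res_step_exists.
  exact: ker_graded_submodule gA.
move=> p; have [D DP] := bA p.+1; exists D.+1 => -[|q] // /DP.
by rewrite (koszul_shift gA kA).
Qed.

Definition next_step l (dl : 'I_l -> nat) (s : res_step dl) :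
    res_step (@step_deg _ _ s) :=
  proj1_sig (constructive_indefinite_description _ (next_step_exists s)).

Lemma next_stepP l (dl : 'I_l -> nat) (s : res_step dl) v :
  im_mx (step_mx (next_step s)) v <-> ker_mx (step_mx s) v.
Proof. by rewrite /next_step; case: constructive_indefinite_description. Qed.

(** Each step has its own target module, so rank and degrees are packed to make the recursion of
    [steps] well typed. *)
Record bundled_step := BundledStep {
  bundled_rank : nat;
  bundled_deg : 'I_bundled_rank -> nat;
  bundled :> res_step bundled_deg }.

Fixpoint steps (s0 : res_step (fun _ : 'I_1 => 0%N)) i : bundled_step :=
  if i is j.+1 then BundledStep (next_step (steps s0 j)) else BundledStep s0.

Lemma homog_diff0 e (p : S) : homog_diff e 0 p = (p \is e.-homog).
Proof. by rewrite /homog_diff subn0; case: eqP => [->|//]; rewrite dhomog0. Qed.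

Lemma min_res_exists (I : S -> Prop) :
    graded_submodule (fun=> 0%N) (fun v : 'rV[S]_1 => I (v 0 0)) ->
    bounded_homology (fun=> 0%N) (fun v : 'rV[S]_1 => I (v 0 0)) ->
  exists F, min_graded_free_resolution I F.
Proof.
move=> gI bI; have [s0 s0P] := res_step_exists gI bI.
pose st := steps s0.
pose F := @FreeSeq k n
  (fun i => step_rank (st i)) (fun i => @step_deg _ _ (st i))
  (fun i => step_mx (st i.+1)) (step_mx (st 0%N)).
exists F; split.
- split=> [a|i a b]; last exact: (step_graded (r := st i.+1) a b).
  by rewrite -homog_diff0; exact: (step_graded (r := s0) a 0).
- split=> [f|v|i v].
  + have := s0P (\row__ f); rewrite mxE => <-; split=> [[w fw]|[w fw]];
    exists w.
      by rewrite -fw mxE.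
    by apply/rowP => j; rewrite ord1 mxE fw.
  + by symmetry; exact: (next_stepP (s := st 0%N) v).
  + by symmetry; exact: (next_stepP (s := st i.+1) v).
(* Minimality: the rows of a map lie in the kernel of the preceding one, whose vectors have no
   constant entries. *)
move=> i a b; have : im_mx (step_mx (st i.+1)) (row a (step_mx (st i.+1))).
  by exists (delta_mx 0 a); rewrite -rowE.
by move/next_stepP/step_minimal => /(_ b); rewrite mxE.
Qed.

Variables (I : S -> Prop) (F : free_seq k n).
Hypothesis resF : min_graded_free_resolution I F.

Local Notation degF := (@deg k n F).

Lemma aug_graded : graded_mx (degF (i := 0%N)) (fun=> 0%N) (aug F).
Proof. by case: resF => -[ga _] _ _ a b; rewrite ord1 homog_diff0. Qed.

Lemma im_diff_constfree i (v : 'rV[S]_(rk F i)) : im_mx (diff F i) v ->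
  constfree v.
Proof.
case: resF => _ _ mF [w ->] a; rewrite mxE raddf_sum big1 //= => b _.
have -> : (w 0 b * diff F i b a)@_0%MM = (w 0 b)@_0%MM * (diff F i b a)@_0%MM.
  exact: rmorphM.
by rewrite mF mulr0.
Qed.

Lemma aug_ker v : ker_mx (aug F) v <-> im_mx (diff F 0) v.
Proof. by case: resF => _ [_ + _] _; apply. Qed.

Lemma diff_ker i v : ker_mx (diff F i) v <-> im_mx (diff F i.+1) v.
Proof. by case: resF => _ [_ _ +] _; apply. Qed.

Lemma diff_graded i : graded_mx (degF (i := i.+1)) (degF (i := i)) (diff F i).
Proof. by case: resF => -[_ gd] _ _; apply: gd. Qed.

(** The augmentation accounts for one shift, and each of the first [i] differentials for another. *)
Lemma koszul_shift_iter i p q :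
  koszul_homology_ne0 (fun=> 0%N) (im_mx (aug F)) (p + i.+1) q <->
  koszul_homology_ne0 (degF (i := i)) (im_mx (diff F i)) p (i.+1 + q).
Proof.
elim: i p q => [|i IH] p q.
  rewrite addn1 (koszul_shift aug_graded) => [|v /aug_ker/im_diff_constfree//].
  by rewrite add1n; apply: eq_koszul_homology aug_ker.
rewrite -addSnnS IH (koszul_shift (diff_graded (i := i))).
  by apply: eq_koszul_homology (@diff_ker i).
by move=> v /diff_ker/im_diff_constfree.
Qed.

(** Shifting down to homological degree 0 reduces this to [degP]. The right-hand side does not
    involve [F]. *)
Lemma deg_resolution i r : (exists a : 'I_(rk F i), deg a = (i + r)%N) <->
  koszul_homology_ne0 (fun=> 0%N) (fun v : 'rV[S]_1 => I (v 0 0)) i r.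
Proof.
have IE (v : 'rV[S]_1) : I (v 0 0) <-> im_mx (aug F) v.
  case: resF => _ [-> _ _] _; split=> -[w wE]; exists w; last by rewrite -wE.
  by apply/rowP => j; rewrite ord1 wE.
rewrite (eq_koszul_homology _ _ _ IE); case: i => [|i].
  by rewrite (degP aug_graded) // => v /aug_ker/im_diff_constfree.
rewrite -[X in koszul_homology_ne0 _ (im_mx (aug F)) X]add0n koszul_shift_iter.
rewrite (degP (diff_graded (i := i))) // => v.
by move/diff_ker/im_diff_constfree.
Qed.
End Resolution.

(** * Regularity *)

Section Regularity.
Variables (k : fieldType) (n : nat) (G : graph n).
Local Notation S := {mpoly k[n]}.

Lemma nonclique_monP (b : 'X_{1..n}) :
  reflect (exists i j, [/\ i != j, ~~ G i j, (0 < b i)%N & (0 < b j)%N])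
          (nonclique_mon G b).
Proof.
apply: (iffP idP) => [/forall_inPn[i ib /forall_inPn[j jb]]
  |[i [j [ij Gij bi bj]]]].
  by rewrite negb_imply => /andP[ij Gij]; exists i, j; rewrite !inE in ib jb.
apply/negP => /cliqueP/(_ i j); rewrite !inE bi bj ij (negPf Gij).
by move=> /(_ isT isT isT).
Qed.

Lemma nonedge_idealP (f : S) :
  nonedge_ideal k G f <-> forall b, ~~ nonclique_mon G b -> f@_b = 0.
Proof.
split=> [[c ->] b bN|f0].
  rewrite raddf_sum big1 // => i _;
    rewrite raddf_sum big1 //= => j /andP[ij Gij].
  rewrite mulrC -mulrA !mcoeffXUM; case: ifP => // bi; case: ifP => // bj.
  case/negP: bN; apply/nonclique_monP; exists i, j; split=> //.
  by move: bj; rewrite mnmBE mnm1E (negPf ij) subn0.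
have closedD f1 f2 : nonedge_ideal k G f1 -> nonedge_ideal k G f2 ->
    nonedge_ideal k G (f1 + f2).
  move=> [c1 ->] [c2 ->]; exists (fun i j => c1 i j + c2 i j).
  rewrite -big_split; apply: eq_bigr => i _; rewrite -big_split.
  by apply: eq_bigr => j _; rewrite mulrDl.
rewrite [f]mpolyE big_seq; apply: big_ind => // [|b].
  exists (fun _ _ => 0); rewrite big1 // => i _; rewrite big1 // => j _.
  by rewrite mul0r.
rewrite mcoeff_msupp => fb.
have /nonclique_monP[i [j [ij Gij bi bj]]] : nonclique_mon G b.
  by apply: contraT => /f0 E; rewrite E eqxx in fb.
exists (fun i' j' => if (i' == i) && (j' == j) then
  f@_b *: 'X_[b - U_(i) - U_(j)] else 0).
rewrite (bigD1 i) //= (bigD1 j) ?ij //= !eqxx big1 ?addr0 =>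
  [|j' /andP[_ /negPf->]]; last first.
  by rewrite mul0r.
rewrite big1 ?addr0 => [|i' /negPf->]; last first.
  by rewrite big1 // => j' _; rewrite mul0r.
rewrite -scalerAl; congr (_ *: _); rewrite -!mpolyXD; congr 'X_[_].
apply/mnmP => x; rewrite !mnmDE !mnmBE !mnm1E.
case: (eqVneq i x) => [<-|_]; first by rewrite eq_sym (negPf ij); lia.
by case: eqVneq => [<-|_]; lia.
Qed.

Lemma ideal_graded_submodule :
  graded_submodule (fun=> 0%N) (fun v : 'rV[S]_1 => nonedge_ideal k G (v 0 0)).
Proof.
split=> [|u v|p v|j v]; rewrite ?mxE !nonedge_idealP.
- by move=> b _; rewrite mcoeff0.
- by move=> uI vI b bN; rewrite mcoeffD uI ?vI ?addr0.
- move=> vI b bN; rewrite mcoeffM big1 // => -[b1 b2] /= /eqP bE.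
  rewrite vI ?mulr0 //;
    apply: contra bN => /nonclique_monP[i [i' [ii' Gii' bi bi']]].
  apply/nonclique_monP; exists i, i'; split=> //; rewrite bE mnmDE.
    by rewrite addn_gt0 bi orbT.
  by rewrite addn_gt0 bi' orbT.
- move=> vI b bN; have [bj|bj] := eqVneq (mdeg b) j; last first.
    by apply: dhomog_nemf_coeff bj; rewrite subn0 pihomogP.
  move: (vI b bN).
  rewrite [v 0 0 in X in X -> _](pihomog_partitionE
    (mf := mdeg) (leq_addr j.+1 _)).
  rewrite raddf_sum /= subn0.
  have jl : (j < mmeasure mdeg (v 0 0)%R + j.+1)%N by rewrite leq_addl.
  rewrite (bigD1 (Ordinal jl)) //= big1 ?addr0 // => i ij.
  apply: (dhomog_nemf_coeff (pihomogP _ _ _)); rewrite /= bj.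
  by apply: contra ij => /eqP E; apply/eqP/val_inj.
Qed.

Lemma koszul_homology_ideal p q :
  koszul_homology_ne0 (fun=> 0%N) (fun v : 'rV[S]_1 =>
    nonedge_ideal k G (v 0 0)) p q <->
  koszul_nonzero k G p q.
Proof.
split=> [[z [zI zp zq zc zb]]|[z [zI zp zq zc zb]]].
  exists (fun s => z s 0 0); split.
  - by move=> s; apply/nonedge_idealP.
  - by move=> s /zp->; rewrite mxE.
  - by move=> s; have := zq s 0; rewrite homog_diff0.
  - by move=> s; rewrite -koszul_col zc mxE.
  move=> [y yI yE]; apply: zb; exists (fun s => (y s)%:M) => s.
    by rewrite nonedge_idealP mxE eqxx mulr1n; apply: yI.
  apply/rowP => j; rewrite ord1 koszul_col -yE.
  by apply: eq_bigr => v _; rewrite mxE eqxx mulr1n.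
exists (fun s => (z s)%:M); split.
- by move=> s; rewrite nonedge_idealP mxE eqxx mulr1n; apply: zI.
- by move=> s /zp->; rewrite raddf0.
- by move=> s a; rewrite homog_diff0 ord1 mxE eqxx mulr1n.
- move=> s; apply/rowP => j; rewrite ord1 koszul_col mxE -[RHS](zc s).
  by apply: eq_bigr => v _; rewrite mxE eqxx mulr1n.
move=> [y yI yE]; apply: zb; exists (fun s => y s 0 0) => s.
  by apply/nonedge_idealP.
by rewrite -koszul_col yE mxE eqxx mulr1n.
Qed.

Lemma betti_ne0 i r : betti (nonedge_ideal k G) i (i + r) <> 0%N <->
  exists2 W : {set 'I_n}, #|W| = (i + r)%N & ~ rel_acyclic k G W r.
Proof.
rewrite -hochster -koszul_homology_ideal.
have resF : min_graded_free_resolution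
  (nonedge_ideal k G) (min_res (nonedge_ideal k G)).
  apply: epsilon_spec; apply: min_res_exists;
    first exact: ideal_graded_submodule.
  (* A class with internal part [q] lives on [p + q] of the [n] vertices. *)
  move=> p; exists n.+1 => q nq;
    rewrite koszul_homology_ideal hochster => -[W Wpq _].
  by move: (max_card (mem W)); rewrite Wpq card_ord; lia.
rewrite -(deg_resolution resF); split=> [/eqP|[a ai]].
  by rewrite cards_eq0 => /set0Pn[a]; rewrite inE => /eqP; exists a.
by apply/eqP; rewrite cards_eq0; apply/set0Pn; exists a; rewrite inE ai.
Qed.

Lemma nonedge_betti : ~~ complete G ->
  betti (nonedge_ideal k G) 0 (0 + 2) <> 0%N.
Proof.
move=> /forallPn[u /forallPn[v]]; rewrite negb_imply => /andP[uv Guv].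
apply: (proj2 (betti_ne0 0 2)); exists [set u; v]; first by rewrite cards2 uv.
by rewrite rel_acyclicP //; apply: nonadj_not_acyclic.
Qed.

(** The set of values contains 2, from a quadratic generator, and is bounded by [n], so [epsilon]
    does return a maximum. *)
Lemma reg_betti : ~~ complete G ->
  is_max (fun r => exists i, betti (nonedge_ideal k G) i (i + r) <> 0%N)
         (reg k G).
Proof.
move=> Gc; rewrite /reg (negPf Gc); apply: epsilon_spec.
set P := (X in is_max X).
have P2 : P 2 by exists 0%N; apply: nonedge_betti.
have Pn r : P r -> (r <= n)%N.
  move=> [i ib]; have [W Wir _] := proj1 (betti_ne0 i r) ib;
    move: (max_card (mem W)).
  by rewrite Wir card_ord; lia.
pose b r : bool := if excluded_middle_informative (P r) then true else false.
have bP r : reflect (P r) (b r).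
  by rewrite /b; case: excluded_middle_informative => h; constructor.
have exb : exists r, b r by exists 2; apply/bP.
have bn r : b r -> (r <= n)%N by move/bP/Pn.
exists (ex_maxn exb bn); case: ex_maxnP => r /bP Pr rmax; split=> // s /bP;
  exact: rmax.
Qed.

Lemma complete_clique : complete G -> clique G setT.
Proof.
move=> /forallP Gc; apply/cliqueP => u v _ _ uv.
by have /forallP/(_ v)/implyP := Gc u; apply.
Qed.

(** A failure in degree [d] is a relative failure in degree [d.+1], and so a nonzero Betti number
    above the regularity. For a complete graph the clique complexes in question are simplices. *)
Lemma reg_acyclic d W : (0 < d)%N -> (reg k G <= d)%N -> acyclic k G W d.
Proof.
move=> d0; case: (boolP (complete G)) => Gc.
  move=> _; apply: clique_acyclic; first by rewrite d0 orbT.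
  by apply: sub_clique (complete_clique Gc); rewrite subsetT.
have [_ regmax] := reg_betti Gc => regd; rewrite -rel_acyclicP //.
apply: NNPP => Wd; have Wcard := rel_acyclic_card Wd.
have := regmax d.+1; rewrite ltnNge regd => regmax'.
(* The subtraction is exact by [rel_acyclic_card]. *)
suff: false by []; apply: regmax'; exists (#|W| - d.+1)%N.
by apply: (proj2 (betti_ne0 _ _)); exists W; rewrite ?subnK.
Qed.

Lemma acyclic_reg t : (0 < t)%N ->
    (forall d (W : {set 'I_n}), (t <= d)%N -> acyclic k G W d) ->
  (reg k G <= t)%N.
Proof.
move=> t0 acG; case: (boolP (complete G)) => Gc; first by rewrite /reg Gc.
have [[i ir] _] := reg_betti Gc; have [W _ Wr] := proj1 (betti_ne0 _ _) ir.
rewrite leqNgt; apply/negP => tr; apply: Wr.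
case: (reg k G) tr => // d td; rewrite rel_acyclicP ?(leq_trans t0) //.
exact: acG.
Qed.

(** Provides the positive degree that [reg_acyclic] needs when it is applied to the separator. *)
Lemma reg_gt0 : (0 < reg k G)%N.
Proof.
case: (boolP (complete G)) => Gc; first by rewrite /reg Gc.
have [_ regmax] := reg_betti Gc; apply: ltnW; apply: regmax.
by exists 0%N; apply: nonedge_betti.
Qed.
End Regularity.

(** * Separators and the induction *)

(** The sides are [T] with the component [C] of [u], and the complement of [C]. A clique that meets
    both [C] and the outside of [T :|: C] would contain an edge that avoids [T] and leaves [C]. *)
Lemma disconnected_sides n (G : graph n) (T : {set 'I_n}) : separator G T ->
  exists A B : {set 'I_n},
    [/\ A :|: B = setT, A :&: B = T, A != setT, B != setT &
        forall s, clique G s -> (s \subset A) || (s \subset B)].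
Proof.
move=> /existsP[u /existsP[v uv]]; set H := induced G (~: T) in u v uv.
pose C : {set 'I_n} := [set enum_val w | w in [set w | connect H u w]].
have uC : enum_val u \in C by apply: imset_f; rewrite inE connect0.
have vC : enum_val v \notin C.
  apply/imsetP => -[w + /enum_val_inj vw]; rewrite inE -vw.
  by rewrite (negPf uv).
have CT x : x \in C -> x \notin T.
  by move=> /imsetP[w _ ->]; have := enum_valP w; rewrite inE.
have vT : enum_val v \notin T by have := enum_valP v; rewrite inE.
exists (T :|: C), (~: C); split.
- by apply/setP => x; rewrite !inE; case: (x \in C); rewrite ?orbT.
- by apply/setP => x; rewrite !inE; have := CT x; case: (x \in C);
  case: (x \in T) => // /(_ isT).
- by apply/eqP => /setP/(_ (enum_val v)); rewrite !inE (negPf vT) (negPf vC).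
- by apply/eqP => /setP/(_ (enum_val u)); rewrite !inE uC.
move=> s /cliqueP cs; case: (boolP (s \subset _)) => //= /subsetPn[y ys].
rewrite !inE negb_or => /andP[yT yC]; apply/subsetP => x xs; rewrite inE.
apply/imsetP => -[w wC xw].
have yT' : y \in ~: T by rewrite inE.
have xy : x != y by apply: contraNneq yC => <-; rewrite xw imset_f.
case/negP: yC; apply/imsetP; exists (enum_rank_in yT' y);
  last by rewrite enum_rankK_in.
move: wC; rewrite !inE => /connect_trans; apply; apply: connect1.
by rewrite /= /induced_adj enum_rankK_in // -xw cs.
Qed.

Local Close Scope ring_scope.

Theorem theorem1p4 (k : fieldType) (char0 : [pchar k]%R =i pred0)
  (F : graph_family) (hF : hereditary F) (t : nat)
  (hsep : forall (n : nat) (G : graph n), F n G -> ~~ complete G ->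
     exists T : {set 'I_n}, separator G T /\ reg k (induced G T) <= t) :
  forall (n : nat) (G : graph n), F n G -> reg k G <= t.+1.
Proof.
(* Induction on the number of vertices, for all graphs of the family at once. Acyclicity of whole
   graphs is enough, since induced subgraphs belong to [F]. *)
have acF : forall N n (G : graph n), (n < N)%N -> F n G ->
  forall d, (t < d)%N -> acyclic k G setT d.
  elim=> // N IH n G nN FG d td.
  have [Gc|Gc] := boolP (complete G).
    apply: clique_acyclic; last exact: complete_clique.
    by rewrite (leq_ltn_trans _ td) ?orbT.
  have [T [sepT regT]] := hsep n G FG Gc.
  have [A [B [AB ABT AT BT cov]]] := disconnected_sides sepT.
  (* Degree [d.+1] on the union asks for degree [d] on [T], where [t <= d]. This is the source of
     the 1 in [t.+1]. *)
  case: d td => // d td.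
  (* Both sides are proper subsets, hence have fewer vertices. *)
  have sub (W : {set 'I_n}) : W != setT -> acyclic k G W d.+1.
    move=> WT; apply: acyclic_induced; apply: IH (hF _ _ _ FG) _ td.
    rewrite -ltnS (leq_trans _ nN) // ltnS -[X in (_ < X)%N]card_ord -cardsT.
    by apply: proper_card; rewrite properT.
  rewrite -AB; apply: mayer_vietoris (sub A AT) (sub B BT) _ => [s _|].
    exact: cov.
  rewrite ABT; apply: acyclic_induced; apply: reg_acyclic.
    by rewrite (leq_trans (leq_trans (reg_gt0 _ _) regT)).
  exact: leq_trans regT td.
move=> n G FG; apply: acyclic_reg => // d W td.
by apply: acyclic_induced; apply: acF (hF _ _ _ FG) _ td.
Qed.
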